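(* Let $0<\alpha<2$, $\mu>0$, $c=1-\frac{\alpha}{2}$ and $E\in\mathbb{R}$. Let $\gamma_\varepsilon(t)$ be a family of non-collision solutions of the $\alpha$-power law problem $$\ddot q=-\mu\alpha\,\frac{q}{|q|^{\alpha+2}},\qquad q\in\mathbb{R}^2,$$ having energy $\frac12|\dot q|^2-\frac{\mu}{|q|^\alpha}=E$, and suppose that $\gamma_\varepsilon$ converges as $\varepsilon\to0$ to a curve $\gamma_*$ having a collision (i.e. passing through the origin). Then $\gamma_*$ parameterizes a piecewise linear curve whose only vertices (points with changing directions of travel) are at the collision (the origin) and at the Hill boundary (if there is one). Away from the origin the limiting curve $\gamma_*$ satisfies Newton's equations (the displayed differential equation). Upon each collision the direction of $\gamma_*$ changes, turning by an angle equal to the scattering angle $\pi/c$.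
   Context: A non-collision solution is one that never reaches the origin $q=0$. The Hill boundary at energy $E$ is the set $\{q: -\mu/|q|^\alpha=E\}$; it is a circle centered at the origin if $E<0$ and is empty if $E\ge 0$. The scattering angle of a collision-free curve in the plane is the measure of the set of rays from the origin, counted with multiplicity, crossed by the curve; for every non-collision zero energy solution of the $\alpha$-power law problem it equals $\pi/c$. That the direction turns at a collision by the scattering angle $\pi/c$ means: if $\gamma_*$ arrives at the origin along the ray $\theta=\theta_-$ and leaves the origin along the ray $\theta=\theta_+$ (where $\theta$ is the polar angle in the plane), then these two rays make the angle $\pi/c$ with each other, i.e. $\theta_+-\theta_-\equiv\pm\pi/c \pmod{2\pi}$. *)

(* Defs.v *)
From Stdlib Require Import Reals.
From Coquelicot Require Import Coquelicot.
Open Scope R_scope.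

Definition plane : NormedModule R_AbsRing :=
  prod_NormedModule R_AbsRing R_NormedModule R_NormedModule.

Lemma norm_planeE (q : plane) : norm q = sqrt (fst q ^ 2 + snd q ^ 2).
Proof.
unfold norm; simpl; unfold prod_norm, norm; simpl; unfold abs; simpl.
apply f_equal; rewrite !Rmult_1_r, <- !Rabs_mult, !Rabs_pos_eq; auto.
- apply Rle_0_sqr.
- apply Rle_0_sqr.
Qed.

(* The open interval (a, b), with -oo and +oo allowed as endpoints. *)
Definition in_oo (a b : Rbar) (t : R) : Prop := Rbar_lt a t /\ Rbar_lt t b.

(* [Rpower 0 _] is a junk value: every use below comes with [q <> zero]. *)
Definition potential (mu alpha : R) (q : plane) : R :=
  - mu / Rpower (norm q) alpha.

Definition force (mu alpha : R) (q : plane) : plane :=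
  scal (- (mu * alpha) / Rpower (norm q) (alpha + 2)) q.

Definition newton (mu alpha : R) (D : R -> Prop) (q v : R -> plane) : Prop :=
  forall t, D t -> is_derive q t (v t) /\ is_derive v t (force mu alpha (q t)).

Definition noncollision_solution (mu alpha E : R) (a b : Rbar)
    (q : R -> plane) : Prop :=
  (forall t, in_oo a b t -> q t <> zero) /\
  exists v : R -> plane,
    newton mu alpha (in_oo a b) q v /\
    forall t, in_oo a b t ->
      1 / 2 * norm (v t) ^ 2 + potential mu alpha (q t) = E.

Definition hill_boundary (mu alpha E : R) (q : plane) : Prop :=
  q <> zero /\ potential mu alpha q = E.

(* Convergence, uniformly on compact subsets of (a, b), as eps tends to 0
   through positive values. *)
Definition converges_to (a b : Rbar) (g : R -> R -> plane) (gs : R -> plane)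
    : Prop :=
  forall s s' : R, in_oo a b s -> in_oo a b s' ->
  forall eta : R, 0 < eta ->
    at_right 0 (fun eps => forall t, s <= t <= s' ->
      norm (minus (g eps t) (gs t)) < eta).

(* On [s, s'] the curve moves along a line, always in the direction of the unit
   vector u; the speed is unconstrained (it is infinite at a collision and zero
   on the Hill boundary). *)
Definition travels_straight (q : R -> plane) (s s' : R) : Prop :=
  exists u : plane, norm u = 1 /\
    forall x y, s <= x -> x < y -> y <= s' ->
      exists k : R, 0 < k /\ minus (q y) (q x) = scal k u.

Definition vertex (q : R -> plane) (t : R) : Prop :=
  ~ exists d : R, 0 < d /\ travels_straight q (t - d) (t + d).

Definition piecewise_linear (a b : Rbar) (q : R -> plane) : Prop :=
  forall s s' : R, in_oo a b s -> in_oo a b s' -> s < s' ->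
  exists (n : nat) (p : nat -> R),
    p 0%nat = s /\ p n = s' /\
    forall i : nat, (i < n)%nat ->
      p i < p (S i) /\ travels_straight q (p i) (p (S i)).

Definition on_ray (theta : R) (q : plane) : Prop :=
  exists r : R, 0 < r /\ q = (r * cos theta, r * sin theta).

Definition arrives_along (q : R -> plane) (t theta : R) : Prop :=
  at_left t (fun s => on_ray theta (q s)).

Definition leaves_along (q : R -> plane) (t theta : R) : Prop :=
  at_right t (fun s => on_ray theta (q s)).

Definition eq_mod_2pi (x y : R) : Prop :=
  exists k : Z, x = y + 2 * PI * IZR k.

Definition turns_by (q : R -> plane) (t phi : R) : Prop :=
  exists theta_in theta_out : R,
    arrives_along q t theta_in /\ leaves_along q t theta_out /\
    (eq_mod_2pi (theta_out - theta_in) phi \/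
     eq_mod_2pi (theta_out - theta_in) (- phi)).

(* Main.v *)
Require Import Defs.
From Stdlib Require Import Reals Ranalysis5 Lra Lia Psatz.
From Coquelicot Require Import Coquelicot.
Open Scope R_scope.

(** Why the theorem is true.  Write [q = (x, y)] for the position, [v] for the
    velocity, [r = |q|], and let [L] be the angular momentum.

    Away from the origin the force is continuous, so Newton's equations pass to
    the uniform limit: subtracting a double primitive of the limiting
    acceleration leaves functions that are nearly affine, whose limit is affine
    ([limit_second_derivative], [limit_motion]).  Velocities converge as well,
    hence so do the energy and the angular momentum.  The latter is constant in
    time, and at most of order [r^(1 - alpha / 2)] when the solution is at a
    small distance [r] from the origin; as the limit reaches the origin, the
    angular momenta tend to 0 ([momentum_vanishes]).  So the limit moves on rays
    ([limit_on_ray]).  On a ray the distance is strictly concave in time, and a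
    change of direction is only possible where the velocity vanishes, which by
    conservation of energy is the Hill boundary ([straight_or_hill]).

    Near the origin [(r^2)'' = 4 E + 2 (2 - alpha) mu / r^alpha] is large and
    positive (the Lagrange-Jacobi identity).  The resulting convexity survives
    in the limit, so that collisions are isolated and the limit leaves each of
    them on a ray, with increasing distance ([collision_convex]).

    For the turning angle let [c = 1 - alpha / 2], let [theta] be the polar
    angle of [q] and let [g = arctan ((q . v) / |L|)], which measures the angle
    between [q] and [v].  At energy 0 the quantity [theta - sign(L) g / c] is
    constant: this is the fact that the complex power [q^c] follows a straight
    line.  At any energy its derivative is at most [kappa g'], where [kappa] is
    as small as desired on a small disc around the origin ([turning_estimate]).
    During a close encounter [q . v] goes from negative to positive while [L]
    is almost 0, so [g] increases by almost [PI]; hence [theta] changes by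
    [PI / c] or [- PI / c] up to an error of order [kappa] ([turning_gap]).
    Since incoming and outgoing rays of the limit do not depend on the size of
    the disc, the error is 0 ([collision_rays]).  No improper integral is
    involved, and angles are never lifted to the real line: the estimate is made
    on the unit vector [q / r] rotated by [- sign(L) g / c]. *)

(** * Calculus on an interval *)

Lemma mean_value (f f' : R -> R) (x y : R) :
  x < y -> (forall t, x <= t <= y -> is_derive f t (f' t)) ->
  exists t, x < t < y /\ f y - f x = f' t * (y - x).
Proof.
intros hxy hf.
destruct (MVT_cor2 f f' x y hxy) as [t [e ht]].
{ intros t ht; apply is_derive_Reals, hf, ht. }
now exists t.
Qed.

Lemma derive_nonneg_incr (f f' : R -> R) (x y : R) :
  x <= y -> (forall t, x <= t <= y -> is_derive f t (f' t)) ->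
  (forall t, x <= t <= y -> 0 <= f' t) -> f x <= f y.
Proof.
intros hxy hf hpos.
destruct (Rle_lt_or_eq_dec _ _ hxy) as [hlt | <-]; [|lra].
destruct (mean_value f f' x y hlt hf) as [t [ht e]].
specialize (hpos t ltac:(lra)); nra.
Qed.

Lemma derive_zero_const (f f' : R -> R) (x y : R) :
  x <= y -> (forall t, x <= t <= y -> is_derive f t (f' t)) ->
  (forall t, x <= t <= y -> f' t = 0) -> f x = f y.
Proof.
intros hxy hf hz.
destruct (Rle_lt_or_eq_dec _ _ hxy) as [hlt | <-]; [|lra].
destruct (mean_value f f' x y hlt hf) as [t [ht e]].
rewrite (hz t ltac:(lra)) in e; lra.
Qed.

Lemma derive_dominated (f f' g g' : R -> R) (k x y : R) :
  x <= y ->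
  (forall t, x <= t <= y -> is_derive f t (f' t)) ->
  (forall t, x <= t <= y -> is_derive g t (g' t)) ->
  (forall t, x <= t <= y -> Rabs (f' t) <= k * g' t) ->
  Rabs (f y - f x) <= k * (g y - g x).
Proof.
intros hxy hf hg hd.
assert (hk : forall t, x <= t <= y -> - (k * g' t) <= f' t <= k * g' t).
{ intros t ht; specialize (hd t ht); split_Rabs; lra. }
assert (h1 : k * g x - f x <= k * g y - f y).
{ apply (derive_nonneg_incr (fun t => k * g t - f t)
    (fun t => k * g' t - f' t) x y hxy).
  - intros t ht; apply (is_derive_minus (V := R_NormedModule)); [|now apply hf].
    apply is_derive_scal; now apply hg.
  - intros t ht; specialize (hk t ht); lra. }
assert (h2 : k * g x + f x <= k * g y + f y).
{ apply (derive_nonneg_incr (fun t => k * g t + f t)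
    (fun t => k * g' t + f' t) x y hxy).
  - intros t ht; apply (is_derive_plus (V := R_NormedModule)); [|now apply hf].
    apply is_derive_scal; now apply hg.
  - intros t ht; specialize (hk t ht); lra. }
split_Rabs; lra.
Qed.

Lemma is_derive_plus_const (f : R -> R) (t d k : R) :
  is_derive f t d -> is_derive (fun s => f s + k) t d.
Proof.
intros hf; rewrite <- (Rplus_0_r d).
apply (is_derive_plus (V := R_NormedModule) f (fun _ => k) t d 0 hf).
apply (is_derive_const (V := R_NormedModule)).
Qed.

(** The chord inequality is stated with a barycentric coordinate so that it
    survives pointwise limits and does not distinguish left from right. *)
Definition convex_between (f : R -> R) (l l' : R) : Prop :=
  forall x z m, l <= x <= l' -> l <= z <= l' -> 0 <= m <= 1 ->
    f (x + m * (z - x)) <= (1 - m) * f x + m * f z.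

Lemma second_derive_convex (f f1 f2 : R -> R) (l l' : R) :
  (forall t, l <= t <= l' -> is_derive f t (f1 t)) ->
  (forall t, l <= t <= l' -> is_derive f1 t (f2 t)) ->
  (forall t, l <= t <= l' -> 0 <= f2 t) ->
  convex_between f l l'.
Proof.
intros hf hf1 hpos.
assert (main : forall x z m, l <= x -> z <= l' -> x < z -> 0 < m < 1 ->
  f (x + m * (z - x)) <= (1 - m) * f x + m * f z).
{ intros x z m hx hz hxz hm; set (y := x + m * (z - x)).
  assert (hy : x < y < z) by (unfold y; nra).
  destruct (mean_value f f1 x y) as [s [hs es]];
    [lra | intros t ht; apply hf; lra |].
  destruct (mean_value f f1 y z) as [r [hr er]];
    [lra | intros t ht; apply hf; lra |].
  assert (h1 : f1 s <= f1 r).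
  { apply (derive_nonneg_incr f1 f2); [lra | |];
      intros t ht; [apply hf1 | apply hpos]; lra. }
  assert (e1 : y - x = m * (z - x)) by (unfold y; ring).
  assert (e2 : z - y = (1 - m) * (z - x)) by (unfold y; ring).
  rewrite e1 in es; rewrite e2 in er.
  assert (h2 : 0 < m * (1 - m) * (z - x)) by (repeat apply Rmult_lt_0_compat; lra).
  assert (h3 : (1 - m) * (f y - f x) <= m * (f z - f y)).
  { rewrite es, er.
    replace ((1 - m) * (f1 s * (m * (z - x)))) with (f1 s * (m * (1 - m) * (z - x))) by ring.
    replace (m * (f1 r * ((1 - m) * (z - x)))) with (f1 r * (m * (1 - m) * (z - x))) by ring.
    nra. }
  lra. }
intros x z m hx hz hm.
destruct (Req_dec m 0) as [-> | m0]; [replace (x + 0 * (z - x)) with x by ring; lra|].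
destruct (Req_dec m 1) as [-> | m1]; [replace (x + 1 * (z - x)) with z by ring; lra|].
destruct (Rtotal_order x z) as [h | [<- | h]].
- apply main; lra.
- replace (x + m * (x - x)) with x by ring; lra.
- replace (x + m * (z - x)) with (z + (1 - m) * (x - z)) by ring.
  assert (h' := main z x (1 - m) ltac:(lra) ltac:(lra) h ltac:(lra)); lra.
Qed.

Lemma second_derive_above_tangent (f f1 f2 : R -> R) (l l' y z : R) :
  (forall t, l <= t <= l' -> is_derive f t (f1 t)) ->
  (forall t, l <= t <= l' -> is_derive f1 t (f2 t)) ->
  (forall t, l <= t <= l' -> 0 <= f2 t) ->
  l <= y <= l' -> l <= z <= l' -> f y + f1 y * (z - y) <= f z.
Proof.
intros hf hf1 hpos hy hz.
destruct (Rtotal_order y z) as [h | [<- | h]]; [| lra |].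
- destruct (mean_value f f1 y z) as [s [hs es]];
    [lra | intros t ht; apply hf; lra |].
  assert (f1 y <= f1 s); [|nra].
  apply (derive_nonneg_incr f1 f2); [lra | |];
    intros t ht; [apply hf1 | apply hpos]; lra.
- destruct (mean_value f f1 z y) as [s [hs es]];
    [lra | intros t ht; apply hf; lra |].
  assert (f1 s <= f1 y); [|nra].
  apply (derive_nonneg_incr f1 f2); [lra | |];
    intros t ht; [apply hf1 | apply hpos]; lra.
Qed.

Lemma convex_between_lim (f : nat -> R -> R) (g : R -> R) (l l' : R) :
  l <= l' ->
  (forall t, l <= t <= l' -> is_lim_seq (fun n => f n t) (g t)) ->
  eventually (fun n => convex_between (f n) l l') -> convex_between g l l'.
Proof.
intros hl hlim hconv x z m hx hz hm.
assert (hy : l <= x + m * (z - x) <= l') by (split; nra).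
refine (is_lim_seq_le_loc (fun n => f n (x + m * (z - x)))
  (fun n => (1 - m) * f n x + m * f n z) (Finite _) (Finite _) _ _ _).
- generalize hconv; apply filter_imp; intros n h; now apply h.
- now apply hlim.
- apply is_lim_seq_plus'; apply is_lim_seq_mult'; try apply is_lim_seq_const; now apply hlim.
Qed.

Lemma is_lim_seq_eps (u : nat -> R) (l : R) :
  (forall e, 0 < e -> eventually (fun n => Rabs (u n - l) < e)) -> is_lim_seq u l.
Proof. intros h; apply is_lim_seq_spec; intros [e he]; now apply h. Qed.

Lemma is_lim_seq_eventually (u : nat -> R) (l e : R) :
  is_lim_seq u l -> 0 < e -> eventually (fun n => Rabs (u n - l) < e).
Proof. intros h he; apply is_lim_seq_spec in h; exact (h (mkposreal e he)). Qed.

(** Composition with [clamp l l'] extends a function that is continuous on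
    [l, l'] to one that is continuous everywhere. *)
Definition clamp (l l' t : R) : R := Rmax l (Rmin t l').

Lemma clamp_id (l l' t : R) : l <= t <= l' -> clamp l l' t = t.
Proof.
intros h; unfold clamp; rewrite Rmin_left by lra; apply Rmax_right; lra.
Qed.

Lemma clamp_between (l l' t : R) : l <= l' -> l <= clamp l l' t <= l'.
Proof.
intros h; unfold clamp, Rmax, Rmin.
destruct (Rle_dec t l'); destruct (Rle_dec l _); lra.
Qed.

Lemma clamp_lipschitz (l l' s t : R) :
  Rabs (clamp l l' s - clamp l l' t) <= Rabs (s - t).
Proof.
unfold clamp, Rmax, Rmin.
destruct (Rle_dec s l'); destruct (Rle_dec t l');
  repeat (destruct (Rle_dec l _)); split_Rabs; lra.
Qed.

Lemma double_primitive (h : R -> R) (l l' : R) :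
  l <= l' -> (forall t, l <= t <= l' -> continuous h t) ->
  exists G G1 : R -> R,
    (forall t, is_derive G t (G1 t)) /\
    (forall t, l <= t <= l' -> is_derive G1 t (h t)).
Proof.
intros hl hh.
set (hc := fun t => h (clamp l l' t)).
assert (prim : forall f : R -> R, (forall t, continuous f t) ->
  forall t, is_derive (RInt f l) t (f t)).
{ intros f hf t; apply is_derive_RInt with (a := l); [|apply hf].
  apply filter_forall; intros b; apply (RInt_correct (V := R_CompleteNormedModule)).
  apply (ex_RInt_continuous (V := R_CompleteNormedModule)); intros; apply hf. }
assert (hcc : forall t, continuous hc t).
{ intros t; apply (continuous_comp (clamp l l') h); [|apply hh, clamp_between, hl].
  apply filterlim_locally; intros [e he].
  exists (mkposreal e he); intros s hs.
  apply Rle_lt_trans with (2 := hs), clamp_lipschitz. }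
exists (RInt (RInt hc l) l), (RInt hc l); split.
- apply prim; intros t; apply (ex_derive_continuous (V := R_NormedModule)).
  exists (hc t); now apply prim.
- intros t ht; replace (h t) with (hc t) by (unfold hc; now rewrite clamp_id).
  now apply prim.
Qed.

(** Differentiating twice commutes with a limit when the second derivatives
    converge uniformly.  With [G] a double primitive of the limit [h], the
    differences [f n - G] have small second derivative, hence are convex and
    concave up to an error tending to 0: their limit [f - G] is affine. *)
Lemma limit_second_derivative (f f1 f2 : nat -> R -> R) (g h : R -> R) (l l' : R) :
  l < l' ->
  (forall n t, l <= t <= l' -> is_derive (f n) t (f1 n t)) ->
  (forall n t, l <= t <= l' -> is_derive (f1 n) t (f2 n t)) ->
  (forall t, l <= t <= l' -> is_lim_seq (fun n => f n t) (g t)) ->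
  (forall eta, 0 < eta -> eventually (fun n => forall t, l <= t <= l' ->
     Rabs (f2 n t - h t) <= eta)) ->
  (forall t, l <= t <= l' -> continuous h t) ->
  exists g1 : R -> R,
    (forall t, l < t < l' -> is_derive g t (g1 t)) /\
    (forall t, l < t < l' -> is_derive g1 t (h t)) /\
    (forall t, l < t < l' -> is_lim_seq (fun n => f1 n t) (g1 t)).
Proof.
intros hl hf hf1 hlim hunif hcont.
destruct (double_primitive h l l') as [G [G1 [hG hG1]]]; [lra | exact hcont |].
(* [s = 1] expresses near convexity and [s = -1] near concavity *)
assert (near_convex : forall s eta, s = 1 \/ s = -1 -> 0 < eta ->
  convex_between (fun t => s * (g t - G t) + eta / 2 * t ^ 2) l l').
{ intros s eta hs heta.
  apply (convex_between_lim (fun n t => s * (f n t - G t) + eta / 2 * t ^ 2)); [lra | |].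
  - intros t ht; apply is_lim_seq_plus'; [|apply is_lim_seq_const].
    apply is_lim_seq_mult'; [apply is_lim_seq_const|].
    apply is_lim_seq_minus'; [now apply hlim | apply is_lim_seq_const].
  - generalize (hunif eta heta); apply filter_imp; intros n hn.
    apply second_derive_convex with
      (f1 := fun t => s * (f1 n t - G1 t) + eta * t)
      (f2 := fun t => s * (f2 n t - h t) + eta).
    + intros t ht; apply (is_derive_plus (V := R_NormedModule)).
      * apply is_derive_scal, (is_derive_minus (V := R_NormedModule));
          [now apply hf | apply hG].
      * auto_derive; [trivial | field].
    + intros t ht; apply (is_derive_plus (V := R_NormedModule)).
      * apply is_derive_scal, (is_derive_minus (V := R_NormedModule));
          [now apply hf1 | now apply hG1].
      * auto_derive; [trivial | ring].
    + intros t ht; specialize (hn t ht); destruct hs as [-> | ->]; split_Rabs; lra. }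
assert (chord : forall s m, s = 1 \/ s = -1 -> 0 <= m <= 1 ->
  s * ((g (l + m * (l' - l)) - G (l + m * (l' - l))) -
    ((1 - m) * (g l - G l) + m * (g l' - G l'))) <= 0).
{ intros s m hs hm; apply le_epsilon; intros e he.
  set (q := (1 - m) * l ^ 2 + m * l' ^ 2 - (l + m * (l' - l)) ^ 2).
  assert (hq : 0 <= q).
  { replace q with (m * (1 - m) * (l' - l) ^ 2) by (unfold q; ring).
    apply Rmult_le_pos; [apply Rmult_le_pos; lra | apply pow2_ge_0]. }
  assert (heta : 0 < 2 * e / (1 + q)).
  { apply Rdiv_lt_0_compat; lra. }
  assert (hc := near_convex s _ hs heta l l' m ltac:(lra) ltac:(lra) hm); cbv beta in hc.
  assert (hb : 2 * e / (1 + q) / 2 * q <= e).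
  { replace (2 * e / (1 + q) / 2 * q) with (e * (q / (1 + q))) by (field; lra).
    assert (q / (1 + q) <= 1) by (apply Rle_div_l; lra). nra. }
  unfold q in hb at 2; lra. }
set (k := ((g l' - G l') - (g l - G l)) / (l' - l)).
assert (affine : forall t, l <= t <= l' -> g t = G t + (g l - G l) + k * (t - l)).
{ intros t ht; set (m := (t - l) / (l' - l)).
  assert (hm : 0 <= m <= 1).
  { unfold m; split; [apply Rle_div_r | apply Rle_div_l]; lra. }
  assert (et : l + m * (l' - l) = t) by (unfold m; field; lra).
  assert (h1 := chord 1 m (or_introl eq_refl) hm).
  assert (h2 := chord (-1) m (or_intror eq_refl) hm).
  rewrite et in h1, h2.
  assert (ek : k * (t - l) = m * ((g l' - G l') - (g l - G l))).
  { unfold k, m; field; lra. }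
  lra. }
assert (hg : forall t, l < t < l' -> is_derive g t (G1 t + k)).
{ intros t ht.
  apply (is_derive_ext_loc (fun t => G t + (g l - G l) + k * (t - l))).
  - assert (hr : 0 < Rmin (t - l) (l' - t)) by (apply Rmin_pos; lra).
    exists (mkposreal _ hr); intros r hb; change (Rabs (r - t) < Rmin (t - l) (l' - t)) in hb.
    symmetry; apply affine.
    assert (h1 := Rmin_l (t - l) (l' - t)); assert (h2 := Rmin_r (t - l) (l' - t)).
    split_Rabs; lra.
  - apply (is_derive_plus (V := R_NormedModule) (fun t => G t + (g l - G l))).
    + apply is_derive_plus_const, hG.
    + auto_derive; [trivial | ring]. }
exists (fun t => G1 t + k); split; [exact hg | split].
- intros t ht; apply is_derive_plus_const, hG1; lra.
- intros t ht.
  (* by the tangent inequality the derivative of [f n - g] at [t] is its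
     difference quotient over [t, t + r], up to [e / 4] *)
  apply is_lim_seq_eps; intros e he.
  set (r := (t + l') / 2 - t).
  assert (hr : 0 < r) by (unfold r; lra).
  assert (heta : 0 < e / (2 * r)) by (apply Rdiv_lt_0_compat; lra).
  assert (hd : 0 < e * r / 8) by nra.
  assert (c1 := is_lim_seq_eventually _ _ _ (hlim t ltac:(lra)) hd).
  assert (c2 := is_lim_seq_eventually _ _ _ (hlim (t + r) ltac:(unfold r; lra)) hd).
  generalize (filter_and _ _ (hunif _ heta) (filter_and _ _ c1 c2)); apply filter_imp.
  intros n [hn [h1 h2]].
  assert (bound : forall s, s = 1 \/ s = -1 ->
    s * (f1 n t - (G1 t + k)) < e).
  { intros s hs.
    assert (htan := second_derive_above_tangent
      (fun v => s * (f n v - g v) + e / (2 * r) / 2 * (v - t) ^ 2)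
      (fun v => s * (f1 n v - (G1 v + k)) + e / (2 * r) * (v - t))
      (fun v => s * (f2 n v - h v) + e / (2 * r)) t (t + r) t (t + r)); cbv beta in htan.
    assert (ht' : s * (f n t - g t) + e / (2 * r) / 2 * (t - t) ^ 2 +
      (s * (f1 n t - (G1 t + k)) + e / (2 * r) * (t - t)) * (t + r - t) <=
      s * (f n (t + r) - g (t + r)) + e / (2 * r) / 2 * (t + r - t) ^ 2).
    { apply htan; try lra.
      - intros v hv; apply (is_derive_plus (V := R_NormedModule)).
        + apply is_derive_scal, (is_derive_minus (V := R_NormedModule));
            [apply hf | apply hg]; unfold r in hv; lra.
        + auto_derive; [trivial | field; lra].
      - intros v hv; apply (is_derive_plus (V := R_NormedModule)).
        + apply is_derive_scal, (is_derive_minus (V := R_NormedModule));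
            [apply hf1; unfold r in hv; lra |].
          apply is_derive_plus_const, hG1; unfold r in hv; lra.
        + auto_derive; [trivial | field; lra].
      - intros v hv; specialize (hn v ltac:(unfold r in hv; lra)).
        destruct hs as [-> | ->]; split_Rabs; lra. }
    assert (eq1 : e / (2 * r) / 2 * (t + r - t) ^ 2 = e * r / 4) by (field; lra).
    rewrite eq1 in ht'.
    assert (s * (f1 n t - (G1 t + k)) * r < e * r); [|nra].
    destruct hs as [-> | ->]; split_Rabs; nra. }
  assert (b1 := bound 1 (or_introl eq_refl)); assert (b2 := bound (-1) (or_intror eq_refl)).
  apply Rabs_def1; lra.
Qed.

(** * Power-law motion in coordinates *)

Definition sqdist (x y : R) : R := x ^ 2 + y ^ 2.

(** The position is [(x, y)] and the velocity [(p, w)].  Scalar coordinates keep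
    all derivatives real-valued. *)
Definition motion (mu alpha E : R) (D : R -> Prop) (x y p w : R -> R) : Prop :=
  forall t, D t ->
    0 < sqdist (x t) (y t) /\
    is_derive x t (p t) /\ is_derive y t (w t) /\
    is_derive p t (- (mu * alpha) /
      Rpower (sqrt (sqdist (x t) (y t))) (alpha + 2) * x t) /\
    is_derive w t (- (mu * alpha) /
      Rpower (sqrt (sqdist (x t) (y t))) (alpha + 2) * y t) /\
    1 / 2 * sqdist (p t) (w t) - mu / Rpower (sqrt (sqdist (x t) (y t))) alpha = E.

Definition virial (x y p w : R) : R := x * p + y * w.
Definition momentum (x y p w : R) : R := x * w - y * p.

(** By the Lagrange-Jacobi identity this is half the second derivative of
    [|q|^2] along a motion of energy [E], at a position with [|q| = r]. *)
Definition lagrange_jacobi (mu alpha E r : R) : R :=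
  2 * E + (2 - alpha) * (mu / Rpower r alpha).

Lemma virial_momentum_sq (x y p w : R) :
  virial x y p w ^ 2 + momentum x y p w ^ 2 = sqdist x y * sqdist p w.
Proof. unfold virial, momentum, sqdist; ring. Qed.

Lemma Rpower_plus_2 (r alpha : R) : 0 < r -> Rpower r (alpha + 2) = Rpower r alpha * r ^ 2.
Proof.
intros hr; rewrite Rpower_plus; f_equal.
now rewrite <- (Rpower_pow 2 r hr).
Qed.

Lemma Rpower_gt_0 (r e : R) : 0 < Rpower r e.
Proof. apply exp_pos. Qed.

Lemma inv_Rpower_large (e K : R) :
  0 < e -> exists rho, 0 < rho /\ forall r, 0 < r <= rho -> K <= / Rpower r e.
Proof.
intros he; set (M := Rabs K + 1).
assert (hM : 0 < M) by (unfold M; generalize (Rabs_pos K); lra).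
exists (Rpower M (- / e)); split; [apply Rpower_gt_0|].
intros r hr; rewrite <- Rpower_Ropp.
apply Rle_trans with M; [unfold M; generalize (Rle_abs K); lra|].
replace M with (Rpower (Rpower M (- / e)) (- e)) at 1.
2:{ rewrite Rpower_mult; replace (- / e * - e) with 1 by (field; lra); now apply Rpower_1. }
rewrite (Rpower_Ropp r), (Rpower_Ropp (Rpower M (- / e))); apply Rinv_le_contravar; [apply Rpower_gt_0|].
apply Rle_Rpower_l; [lra | split; lra].
Qed.

Lemma Rpower_small (e eta : R) :
  0 < e -> 0 < eta -> exists rho, 0 < rho /\ forall r, 0 < r <= rho -> Rpower r e <= eta.
Proof.
intros he heta.
destruct (inv_Rpower_large e (/ eta) he) as [rho [h0 h]]; exists rho; split; [exact h0|].
intros r hr; specialize (h r hr).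
rewrite <- (Rinv_inv eta), <- (Rinv_inv (Rpower r e)).
apply Rinv_le_contravar; [now apply Rinv_0_lt_compat | exact h].
Qed.

Lemma lagrange_jacobi_large (mu alpha E K : R) :
  0 < alpha < 2 -> 0 < mu ->
  exists rho, 0 < rho /\ forall r, 0 < r <= rho -> K <= lagrange_jacobi mu alpha E r.
Proof.
intros ha hmu.
destruct (inv_Rpower_large alpha ((K - 2 * E) / ((2 - alpha) * mu))) as [rho [h0 h]]; [lra|].
exists rho; split; [exact h0|]; intros r hr; specialize (h r hr).
unfold lagrange_jacobi; unfold Rdiv at 1.
apply Rle_div_l in h; [|apply Rmult_lt_0_compat; lra]. nra.
Qed.

Section Derivatives.
Context (mu alpha E : R) (D : R -> Prop) (x y p w : R -> R).
Context (hm : motion mu alpha E D x y p w).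

Lemma motion_sqdist_derive (t : R) : D t ->
  is_derive (fun s => sqdist (x s) (y s)) t (2 * virial (x t) (y t) (p t) (w t)).
Proof.
intros ht; destruct (hm t ht) as [h0 [hx [hy _]]]; unfold sqdist, virial.
auto_derive.
- repeat split; eexists; eassumption.
- rewrite (is_derive_unique (fun s : R => x s) _ _ hx), (is_derive_unique (fun s : R => y s) _ _ hy); ring.
Qed.

Lemma motion_speed (t : R) : D t ->
  sqdist (p t) (w t) = lagrange_jacobi mu alpha E (sqrt (sqdist (x t) (y t))) +
    mu * alpha / Rpower (sqrt (sqdist (x t) (y t))) alpha.
Proof.
intros ht; destruct (hm t ht) as [h0 [_ [_ [_ [_ he]]]]].
unfold lagrange_jacobi; generalize (Rpower_gt_0 (sqrt (sqdist (x t) (y t))) alpha).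
intros hP; revert he; unfold Rdiv; nra.
Qed.

Lemma motion_virial_derive (t : R) : D t ->
  is_derive (fun s => virial (x s) (y s) (p s) (w s)) t
    (lagrange_jacobi mu alpha E (sqrt (sqdist (x t) (y t)))).
Proof.
intros ht; assert (hs := motion_speed t ht).
destruct (hm t ht) as [h0 [hx [hy [hp [hw _]]]]].
assert (hr : 0 < sqrt (sqdist (x t) (y t))) by (now apply sqrt_lt_R0).
assert (hP := Rpower_gt_0 (sqrt (sqdist (x t) (y t))) alpha).
rewrite Rpower_plus_2, pow2_sqrt in hp, hw by lra.
unfold virial; auto_derive.
- repeat split; eexists; eassumption.
- rewrite (is_derive_unique (fun s : R => x s) _ _ hx), (is_derive_unique (fun s : R => y s) _ _ hy),
    (is_derive_unique (fun s : R => p s) _ _ hp), (is_derive_unique (fun s : R => w s) _ _ hw).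
  apply (Rplus_eq_reg_r (mu * alpha / Rpower (sqrt (sqdist (x t) (y t))) alpha)).
  rewrite <- hs; revert h0 hP; unfold sqdist; intros h0 hP; field; split; lra.
Qed.

Lemma motion_momentum_derive (t : R) : D t ->
  is_derive (fun s => momentum (x s) (y s) (p s) (w s)) t 0.
Proof.
intros ht; destruct (hm t ht) as [h0 [hx [hy [hp [hw _]]]]].
unfold momentum; auto_derive.
- repeat split; eexists; eassumption.
- rewrite (is_derive_unique (fun s : R => x s) _ _ hx), (is_derive_unique (fun s : R => y s) _ _ hy),
    (is_derive_unique (fun s : R => p s) _ _ hp), (is_derive_unique (fun s : R => w s) _ _ hw); ring.
Qed.

(** The unit vector [q / |q|] rotates at the angular speed
    [momentum / |q|^2]. *)
Lemma motion_direction_derive (t : R) : D t ->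
  let omega := momentum (x t) (y t) (p t) (w t) / sqdist (x t) (y t) in
  let r := sqrt (sqdist (x t) (y t)) in
  is_derive (fun s => x s / sqrt (sqdist (x s) (y s))) t (- omega * (y t / r)) /\
  is_derive (fun s => y s / sqrt (sqdist (x s) (y s))) t (omega * (x t / r)).
Proof.
intros ht omega r; assert (hN := motion_sqdist_derive t ht).
destruct (hm t ht) as [h0 [hx [hy _]]].
assert (hr : 0 < r) by (now apply sqrt_lt_R0).
assert (er : r * r = sqdist (x t) (y t)) by (apply sqrt_sqrt; lra).
assert (hS := is_derive_sqrt _ _ _ hN h0); fold r in hS.
assert (hr' : sqrt (sqdist (x t) (y t)) <> 0) by (fold r; lra).
assert (dx := is_derive_div _ _ _ _ _ hx hS hr').
assert (dy := is_derive_div _ _ _ _ _ hy hS hr').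
cbv beta in dx, dy; fold r in dx, dy.
assert (es : x t ^ 2 + y t ^ 2 = r ^ 2) by (unfold sqdist in er; lra).
split.
- replace (- omega * (y t / r)) with ((p t * r - x t *
    (2 * virial (x t) (y t) (p t) (w t) / (2 * r))) / r ^ 2); [exact dx|].
  unfold omega; rewrite <- er; unfold virial, momentum.
  transitivity ((p t * r ^ 2 - x t * (x t * p t + y t * w t)) / r ^ 3); [field; lra|].
  rewrite <- es; field; lra.
- replace (omega * (x t / r)) with ((w t * r - y t *
    (2 * virial (x t) (y t) (p t) (w t) / (2 * r))) / r ^ 2); [exact dy|].
  unfold omega; rewrite <- er; unfold virial, momentum.
  transitivity ((w t * r ^ 2 - y t * (x t * p t + y t * w t)) / r ^ 3); [field; lra|].
  rewrite <- es; field; lra.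
Qed.

End Derivatives.

Lemma motion_momentum_const (mu alpha E : R) (D : R -> Prop) (x y p w : R -> R) (l l' : R) :
  motion mu alpha E D x y p w -> l <= l' -> (forall t, l <= t <= l' -> D t) ->
  momentum (x l) (y l) (p l) (w l) = momentum (x l') (y l') (p l') (w l').
Proof.
intros hm hl hD.
apply (derive_zero_const (fun t => momentum (x t) (y t) (p t) (w t)) (fun _ => 0) l l' hl); auto.
intros t ht; apply (motion_momentum_derive _ _ _ _ _ _ _ _ hm), hD, ht.
Qed.

Lemma motion_direction_const (mu alpha E : R) (D : R -> Prop) (x y p w : R -> R) (l l' : R) :
  motion mu alpha E D x y p w -> l <= l' -> (forall t, l <= t <= l' -> D t) ->
  (forall t, l <= t <= l' -> momentum (x t) (y t) (p t) (w t) = 0) ->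
  x l / sqrt (sqdist (x l) (y l)) = x l' / sqrt (sqdist (x l') (y l')) /\
  y l / sqrt (sqdist (x l) (y l)) = y l' / sqrt (sqdist (x l') (y l')).
Proof.
intros hm hl hD hL.
assert (hd : forall t, l <= t <= l' ->
  is_derive (fun s => x s / sqrt (sqdist (x s) (y s))) t 0 /\
  is_derive (fun s => y s / sqrt (sqdist (x s) (y s))) t 0).
{ intros t ht; assert (d := motion_direction_derive _ _ _ _ _ _ _ _ hm t (hD t ht)).
  cbv zeta in d; rewrite (hL t ht) in d.
  replace (0 / sqdist (x t) (y t)) with 0 in d by (unfold Rdiv; ring).
  rewrite Ropp_0, !Rmult_0_l in d; exact d. }
split.
- apply (derive_zero_const (fun s => x s / sqrt (sqdist (x s) (y s))) (fun _ => 0) l l' hl); auto.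
  intros t ht; apply (hd t ht).
- apply (derive_zero_const (fun s => y s / sqrt (sqdist (x s) (y s))) (fun _ => 0) l l' hl); auto.
  intros t ht; apply (hd t ht).
Qed.

(** * Rotations of the plane *)

(** [rotx th] and [roty th] are the coordinates after the rotation by [- th]. *)
Definition rotx (th u v : R) : R := u * cos th + v * sin th.
Definition roty (th u v : R) : R := v * cos th - u * sin th.

Lemma rot_sqdist (th u v : R) : sqdist (rotx th u v) (roty th u v) = sqdist u v.
Proof.
assert (h := sin2_cos2 th); unfold Rsqr in h; unfold rotx, roty, sqdist.
transitivity ((u ^ 2 + v ^ 2) * (sin th * sin th + cos th * cos th)); [ring | rewrite h; ring].
Qed.

Lemma Rabs_le_1_of_sqdist (u v : R) : sqdist u v = 1 -> Rabs u <= 1 /\ Rabs v <= 1.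
Proof. unfold sqdist; intros h; split; split_Rabs; nra. Qed.

Lemma sqdist_direction (x y : R) :
  0 < sqdist x y -> sqdist (x / sqrt (sqdist x y)) (y / sqrt (sqdist x y)) = 1.
Proof.
intros h; assert (hr := sqrt_lt_R0 _ h); assert (e := sqrt_sqrt _ (Rlt_le _ _ h)).
unfold sqdist at 1; set (r := sqrt (sqdist x y)) in *.
transitivity (sqdist x y / (r * r)); [unfold sqdist; field; lra | rewrite e; field; lra].
Qed.

Lemma polar_angle (u v : R) : sqdist u v = 1 -> exists th, u = cos th /\ v = sin th.
Proof.
intros h; assert (hu : -1 <= u <= 1) by (unfold sqdist in h; split; nra).
assert (hs : sin (acos u) = Rabs v).
{ rewrite sin_acos by exact hu; rewrite <- sqrt_Rsqr_abs; f_equal.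
  unfold Rsqr, sqdist in *; lra. }
destruct (Rle_dec 0 v) as [hv | hv].
- exists (acos u); rewrite cos_acos, hs, Rabs_pos_eq; auto.
- exists (- acos u); rewrite cos_neg, sin_neg, cos_acos, hs, Rabs_left by lra; lra.
Qed.

Lemma rotx_polar (ph th : R) : rotx ph (cos th) (sin th) = cos (th - ph).
Proof. unfold rotx; rewrite cos_minus; ring. Qed.

Lemma roty_polar (ph th : R) : roty ph (cos th) (sin th) = sin (th - ph).
Proof. unfold roty; rewrite sin_minus; ring. Qed.

Lemma rot_inverse (ph u v : R) :
  rotx (- ph) (rotx ph u v) (roty ph u v) = u /\ roty (- ph) (rotx ph u v) (roty ph u v) = v.
Proof.
assert (h := sin2_cos2 ph); unfold Rsqr in h.
unfold rotx, roty; rewrite cos_neg, sin_neg; split.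
- transitivity (u * (sin ph * sin ph + cos ph * cos ph)); [ring | rewrite h; ring].
- transitivity (v * (sin ph * sin ph + cos ph * cos ph)); [ring | rewrite h; ring].
Qed.

Lemma is_lim_seq_rot (ph u v : nat -> R) (ph0 u0 v0 : R) :
  is_lim_seq ph ph0 -> is_lim_seq u u0 -> is_lim_seq v v0 ->
  is_lim_seq (fun n => rotx (ph n) (u n) (v n)) (rotx ph0 u0 v0) /\
  is_lim_seq (fun n => roty (ph n) (u n) (v n)) (roty ph0 u0 v0).
Proof.
intros hph hu hv.
assert (hc := is_lim_seq_continuous cos _ _ (continuity_cos ph0) hph).
assert (hs := is_lim_seq_continuous sin _ _ (continuity_sin ph0) hph).
split; [apply is_lim_seq_plus' | apply is_lim_seq_minus']; now apply is_lim_seq_mult'.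
Qed.

(** This vanishes exactly when the direction [e] is [f] turned by [2 * ph].
    The rotation is split evenly over [e] and [f] because these are the
    directions after and before an encounter, where [g] is close to [PI / 2] and
    to [- PI / 2]. *)
Definition rot_gap (ph eu ev fu fv : R) : R :=
  sqdist (rotx ph eu ev - rotx (- ph) fu fv) (roty ph eu ev - roty (- ph) fu fv).

Lemma sqdist_eq_0 (u v : R) : sqdist u v = 0 -> u = 0 /\ v = 0.
Proof. unfold sqdist; intros h; split; nra. Qed.

Lemma rot_gap_polar (ph eu ev th : R) :
  rot_gap ph eu ev (cos th) (sin th) = 0 ->
  eu = cos (th + 2 * ph) /\ ev = sin (th + 2 * ph).
Proof.
unfold rot_gap; rewrite rotx_polar, roty_polar.
replace (th - - ph) with (th + ph) by ring; intros h; apply sqdist_eq_0 in h.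
assert (h1 : rotx ph eu ev = cos (th + ph)) by lra.
assert (h2 : roty ph eu ev = sin (th + ph)) by lra.
destruct (rot_inverse ph eu ev) as [h3 h4].
rewrite h1, h2, rotx_polar in h3; rewrite h1, h2, roty_polar in h4.
rewrite <- h3, <- h4; split; f_equal; ring.
Qed.

(** * The turning estimate *)

(** The derivatives of the polar angle [theta] and of [g] are [L / |q|^2] and
    [|L| J / (|q|^2 |v|^2)], where [J] is the Lagrange-Jacobi expression.  Since
    [c |v|^2 - J = - alpha E] with [c = 1 - alpha / 2], they are proportional up
    to a relative error [alpha |E| / (c J)], which is small near the origin.
    This bounds the speed of the unit vector [q / |q|] seen in a frame turning
    with [s g / c] by a multiple of [g'], whose integral is at most [PI]. *)
Lemma turning_estimate (mu alpha E : R) (x y p w : R -> R) (l l' s ell kappa : R) :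
  0 < alpha < 2 -> 0 < mu -> l <= l' -> s = 1 \/ s = -1 -> 0 < ell -> 0 < kappa ->
  motion mu alpha E (fun t => l <= t <= l') x y p w ->
  (forall t, l <= t <= l' -> momentum (x t) (y t) (p t) (w t) = s * ell) ->
  (forall t, l <= t <= l' ->
    Rmax 1 (alpha * Rabs E / ((1 - alpha / 2) * kappa)) <=
    lagrange_jacobi mu alpha E (sqrt (sqdist (x t) (y t)))) ->
  let g := fun t => atan (virial (x t) (y t) (p t) (w t) / ell) in
  let u := fun t => x t / sqrt (sqdist (x t) (y t)) in
  let v := fun t => y t / sqrt (sqdist (x t) (y t)) in
  let W1 := fun t => rotx (s * (g t / (1 - alpha / 2))) (u t) (v t) in
  let W2 := fun t => roty (s * (g t / (1 - alpha / 2))) (u t) (v t) in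
  Rabs (W1 l' - W1 l) <= kappa * (g l' - g l) /\
  Rabs (W2 l' - W2 l) <= kappa * (g l' - g l).
Proof.
intros ha hmu hl hs hell hkappa hm hL hJ g u v W1 W2.
set (c := 1 - alpha / 2) in *; assert (hc : 0 < c) by (unfold c; lra).
set (J := fun t => lagrange_jacobi mu alpha E (sqrt (sqdist (x t) (y t)))).
set (S := fun t => virial (x t) (y t) (p t) (w t)).
set (omega := fun t => s * ell / sqdist (x t) (y t)).
set (g' := fun t => J t / ell / (1 + (S t / ell) ^ 2)).
assert (dg : forall t, l <= t <= l' -> is_derive g t (g' t)).
{ intros t ht.
  assert (dS : is_derive S t (J t)) by exact (motion_virial_derive _ _ _ _ _ _ _ _ hm t ht).
  change (is_derive (fun t => atan (S t / ell)) t (g' t)); unfold g'.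
  clearbody S J; clear - dS hell; auto_derive; [eexists; exact dS|].
  rewrite (is_derive_unique (fun s : R => S s) _ _ dS).
  field; repeat split; try lra; nra. }
assert (du : forall t, l <= t <= l' -> is_derive u t (- omega t * v t) /\
   is_derive v t (omega t * u t)).
{ intros t ht; assert (d := motion_direction_derive _ _ _ _ _ _ _ _ hm t ht).
  cbv zeta in d; rewrite (hL t ht) in d; exact d. }
assert (dW : forall t, l <= t <= l' ->
  is_derive W1 t ((s * (g' t / c) - omega t) * W2 t) /\
  is_derive W2 t ((omega t - s * (g' t / c)) * W1 t)).
{ intros t ht; destruct (du t ht) as [d1 d2]; assert (d3 := dg t ht).
  unfold W1, W2, rotx, roty; split; auto_derive;
    try (repeat split; eexists; eassumption);
    rewrite (is_derive_unique (fun s : R => g s) _ _ d3),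
      (is_derive_unique (fun s : R => u s) _ _ d1), (is_derive_unique (fun s : R => v s) _ _ d2);
    unfold Rdiv; ring. }
assert (key : forall t, l <= t <= l' ->
  Rabs (omega t - s * (g' t / c)) <= kappa * g' t).
{ intros t ht; assert (hJt := hJ t ht); fold (J t) in hJt.
  assert (hV := motion_speed _ _ _ _ _ _ _ _ hm t ht); fold (J t) in hV.
  destruct (hm t ht) as [h0 [_ [_ [_ [_ he]]]]].
  assert (hi := virial_momentum_sq (x t) (y t) (p t) (w t)).
  rewrite (hL t ht) in hi; fold (S t) in hi.
  assert (hs2 : s ^ 2 = 1) by (destruct hs as [-> | ->]; ring).
  assert (h1 := Rmax_l 1 (alpha * Rabs E / (c * kappa))).
  assert (h2 := Rmax_r 1 (alpha * Rabs E / (c * kappa))).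
  assert (hmp : 0 < mu * alpha / Rpower (sqrt (sqdist (x t) (y t))) alpha).
  { apply Rdiv_lt_0_compat; [nra | apply Rpower_gt_0]. }
  set (N := sqdist (x t) (y t)) in *; set (V := sqdist (p t) (w t)) in *.
  assert (hVp : 1 < V) by lra.
  assert (eg : g' t = J t * ell / (N * V)).
  { unfold g'; assert (hd : ell ^ 2 + S t ^ 2 = N * V) by nra.
    rewrite <- hd; field; split; nra. }
  assert (ecV : c * V - J t = - (alpha * E)).
  { unfold c; rewrite hV; revert he hV; unfold J, lagrange_jacobi; fold N; unfold Rdiv; nra. }
  replace (omega t - s * (g' t / c)) with (s * (ell / (N * V * c) * (c * V - J t))).
  2:{ rewrite eg; unfold omega; fold N; field; lra. }
  assert (hpos : 0 < ell / (N * V * c)).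
  { apply Rdiv_lt_0_compat; [lra | repeat apply Rmult_lt_0_compat; lra]. }
  replace (kappa * g' t) with (ell / (N * V * c) * (c * kappa * J t)).
  2:{ rewrite eg; field; lra. }
  rewrite ecV.
  assert (hE : alpha * Rabs E <= c * kappa * J t).
  { apply Rle_trans with (2 := Rmult_le_compat_l (c * kappa) _ _
      (Rmult_le_pos _ _ (Rlt_le _ _ hc) (Rlt_le _ _ hkappa)) (Rle_trans _ _ _ h2 hJt)).
    right; field; lra. }
  rewrite 2!Rabs_mult, (Rabs_pos_eq (ell / _)), Rabs_Ropp, Rabs_mult, (Rabs_pos_eq alpha) by lra.
  replace (Rabs s) with 1 by (destruct hs as [-> | ->]; unfold Rabs; destruct Rcase_abs; lra).
  rewrite Rmult_1_l; apply Rmult_le_compat_l; lra. }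
assert (hW : forall t, l <= t <= l' -> Rabs (W1 t) <= 1 /\ Rabs (W2 t) <= 1).
{ intros t ht; apply Rabs_le_1_of_sqdist; unfold W1, W2.
  rewrite rot_sqdist; apply sqdist_direction, (hm t ht). }
split.
- apply (derive_dominated W1 (fun t => (s * (g' t / c) - omega t) * W2 t) g g');
    [exact hl | intros t ht; now apply dW | exact dg |].
  intros t ht; rewrite Rabs_mult, Rabs_minus_sym.
  generalize (key t ht) (proj2 (hW t ht)) (Rabs_pos (omega t - s * (g' t / c)))
    (Rabs_pos (W2 t)); nra.
- apply (derive_dominated W2 (fun t => (omega t - s * (g' t / c)) * W1 t) g g');
    [exact hl | intros t ht; now apply dW | exact dg |].
  intros t ht; rewrite Rabs_mult.
  generalize (key t ht) (proj1 (hW t ht)) (Rabs_pos (omega t - s * (g' t / c)))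
    (Rabs_pos (W1 t)); nra.
Qed.

(** * Subdivisions and straight motion *)

(** The supremum of the points reachable from [l] by a subdivision is itself
    reachable, by the left half of the local hypothesis; by the right half it
    can be passed unless it is [l']. *)
Lemma subdivide (P : R -> R -> Prop) (l l' : R) :
  l <= l' ->
  (forall s s' r r', P s s' -> s <= r -> r < r' -> r' <= s' -> P r r') ->
  (forall t, l <= t <= l' -> exists d, 0 < d /\ P (t - d) t /\ P t (t + d)) ->
  exists (n : nat) (p : nat -> R), p 0%nat = l /\ p n = l' /\
    forall i : nat, (i < n)%nat -> p i < p (S i) /\ P (p i) (p (S i)).
Proof.
intros hl hsub hloc.
set (reach := fun z => exists (n : nat) (p : nat -> R), p 0%nat = l /\ p n = z /\
    forall i : nat, (i < n)%nat -> p i < p (S i) /\ P (p i) (p (S i))).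
assert (extend : forall z z', reach z -> z < z' -> P z z' -> reach z').
{ intros z z' [n [p [h0 [hn hi]]]] hz hP.
  exists (S n), (fun i => if (i <=? n)%nat then p i else z'); repeat split.
  - exact h0.
  - destruct (Nat.leb_spec (S n) n); [lia | reflexivity].
  - destruct (Nat.leb_spec i n); [|lia]; destruct (Nat.leb_spec (S i) n).
    + apply hi; lia.
    + replace i with n by lia; lra.
  - destruct (Nat.leb_spec i n); [|lia]; destruct (Nat.leb_spec (S i) n).
    + apply hi; lia.
    + replace i with n by lia; now rewrite hn. }
set (A := fun z => l <= z <= l' /\ reach z).
assert (hAl : A l).
{ split; [lra|]; exists 0%nat, (fun _ => l); repeat split; intros; lia. }
destruct (completeness A) as [T [hub hleast]].
{ exists l'; intros z [hz _]; lra. }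
{ now exists l. }
assert (hT : l <= T <= l').
{ split; [now apply hub | apply hleast; intros z [hz _]; lra]. }
destruct (hloc T hT) as [d [hd [hPl hPr]]].
assert (hAT : reach T).
{ destruct (Classical_Prop.classic (exists z, A z /\ T - d < z)) as [[z [[hz hr] hlt]] | hno].
  - assert (hzT : z <= T) by (apply hub; split; assumption).
    destruct (Rle_lt_or_eq_dec _ _ hzT) as [h | <-]; [|exact hr].
    apply (extend z T hr h), (hsub (T - d) T); auto; lra.
  - exfalso; assert (h : T <= T - d); [|lra].
    apply hleast; intros z hz; apply Rnot_lt_le; intros hlt; apply hno; now exists z. }
destruct (Rle_lt_or_eq_dec _ _ (proj2 hT)) as [h | <-]; [|exact hAT].
exfalso; assert (h1 := Rmin_l (T + d) l'); assert (h2 := Rmin_r (T + d) l').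
assert (h3 : T < Rmin (T + d) l') by (apply Rmin_glb_lt; lra).
assert (h4 : Rmin (T + d) l' <= T); [|lra].
apply hub; split; [lra|].
apply (extend T _ hAT h3), (hsub T (T + d)); auto; lra.
Qed.

Lemma travels_straight_sub (q : R -> plane) (s s' r r' : R) :
  travels_straight q s s' -> s <= r -> r' <= s' -> travels_straight q r r'.
Proof.
intros [u [hu h]] h1 h2; exists u; split; [exact hu|].
intros x y hx hxy hy; apply h; lra.
Qed.

Lemma travels_along_axis (q : R -> plane) (s s' u v : R) (rho : R -> R) :
  sqdist u v = 1 ->
  (forall t, s <= t <= s' -> q t = (rho t * u, rho t * v)) ->
  (forall x y, s <= x -> x < y -> y <= s' -> rho x < rho y) ->
  travels_straight q s s'.
Proof.
intros huv hq hrho; exists ((u, v) : plane); split.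
- rewrite norm_planeE; simpl fst; simpl snd; fold (sqdist u v); now rewrite huv, sqrt_1.
- intros x y hx hxy hy; exists (rho y - rho x); split; [generalize (hrho x y hx hxy hy); lra|].
  rewrite (hq x), (hq y) by lra.
  apply injective_projections.
  + change (rho y * u - rho x * u = (rho y - rho x) * u); ring.
  + change (rho y * v - rho x * v = (rho y - rho x) * v); ring.
Qed.

Lemma travels_along_axis_back (q : R -> plane) (s s' u v : R) (rho : R -> R) :
  sqdist u v = 1 ->
  (forall t, s <= t <= s' -> q t = (rho t * u, rho t * v)) ->
  (forall x y, s <= x -> x < y -> y <= s' -> rho y < rho x) ->
  travels_straight q s s'.
Proof.
intros huv hq hrho; apply (travels_along_axis q s s' (- u) (- v) (fun t => - rho t)).
- rewrite <- huv; unfold sqdist; ring.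
- intros t ht; rewrite (hq t ht); apply injective_projections; simpl; ring.
- intros x y hx hxy hy; generalize (hrho x y hx hxy hy); lra.
Qed.

(** * The limit away from the origin *)

Lemma in_oo_segment (a b : Rbar) (l l' t : R) :
  in_oo a b l -> in_oo a b l' -> l <= t <= l' -> in_oo a b t.
Proof.
intros [h1 _] [_ h2] ht; split.
- apply Rbar_lt_le_trans with (1 := h1); simpl; lra.
- apply Rbar_le_lt_trans with (2 := h2); simpl; lra.
Qed.

Lemma in_oo_neighbourhood (a b : Rbar) (t : R) :
  in_oo a b t -> exists d, 0 < d /\ forall s, t - d <= s <= t + d -> in_oo a b s.
Proof.
intros ht.
assert (h : locally t (in_oo a b)).
{ apply filter_and; [apply (open_Rbar_gt' t a) | apply (open_Rbar_lt' t b)]; apply ht. }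
destruct h as [[d hd] h]; exists (d / 2); split; [lra|].
intros s hs; apply h; change (Rabs (s - t) < d); split_Rabs; lra.
Qed.

Lemma sqdist_nonneg (x y : R) : 0 <= sqdist x y.
Proof. unfold sqdist; nra. Qed.

Lemma radius_lipschitz (x y x' y' : R) :
  Rabs (sqrt (sqdist x y) - sqrt (sqdist x' y')) <= Rabs (x - x') + Rabs (y - y').
Proof.
assert (tri : forall x y x' y', sqrt (sqdist x y) <=
  sqrt (sqdist x' y') + (Rabs (x - x') + Rabs (y - y'))).
{ clear; intros x y x' y'.
  assert (h0 := sqrt_pos (sqdist x' y')); assert (e := sqrt_sqrt _ (sqdist_nonneg x' y')).
  set (r := sqrt (sqdist x' y')) in *.
  assert (hx := Rabs_pos (x - x')); assert (hy := Rabs_pos (y - y')).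
  rewrite <- (sqrt_Rsqr (r + (Rabs (x - x') + Rabs (y - y')))) by lra.
  apply sqrt_le_1_alt; unfold Rsqr.
  assert (bx : Rabs x' <= r) by (
    rewrite <- (sqrt_Rsqr_abs x'); apply sqrt_le_1_alt; unfold Rsqr, sqdist; nra).
  assert (by' : Rabs y' <= r) by (
    rewrite <- (sqrt_Rsqr_abs y'); apply sqrt_le_1_alt; unfold Rsqr, sqdist; nra).
  assert (cx : x' * (x - x') <= r * Rabs (x - x')).
  { apply Rle_trans with (1 := Rle_abs _); rewrite Rabs_mult; nra. }
  assert (cy : y' * (y - y') <= r * Rabs (y - y')).
  { apply Rle_trans with (1 := Rle_abs _); rewrite Rabs_mult; nra. }
  assert (sx : Rabs (x - x') * Rabs (x - x') = (x - x') * (x - x')) by (split_Rabs; ring).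
  assert (sy : Rabs (y - y') * Rabs (y - y') = (y - y') * (y - y')) by (split_Rabs; ring).
  unfold sqdist in *; nra. }
assert (h1 := tri x y x' y'); assert (h2 := tri x' y' x y).
rewrite (Rabs_minus_sym x'), (Rabs_minus_sym y') in h2.
apply Rabs_le; lra.
Qed.

Lemma inv_Rpower_lipschitz (e m : R) : 0 < e -> 0 < m ->
  exists C, 0 < C /\ forall r r', m <= r -> m <= r' ->
    Rabs (/ Rpower r e - / Rpower r' e) <= C * Rabs (r - r').
Proof.
intros he hm; exists (e * / Rpower m (e + 1)); split.
{ apply Rmult_lt_0_compat; [lra | apply Rinv_0_lt_compat, Rpower_gt_0]. }
assert (main : forall r r', m <= r -> r < r' ->
    Rabs (/ Rpower r e - / Rpower r' e) <= e * / Rpower m (e + 1) * Rabs (r - r')).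
{ intros r r' hr hr'.
  destruct (mean_value (fun r => Rpower r (- e)) (fun r => - e * Rpower r (- e - 1)) r r' hr')
    as [z [hz ez]].
  { intros t ht; apply is_derive_Reals, derivable_pt_lim_power; lra. }
  rewrite <- !Rpower_Ropp, Rabs_minus_sym, ez, (Rabs_minus_sym r), !Rabs_mult.
  apply Rmult_le_compat_r; [apply Rabs_pos|].
  rewrite Rabs_Ropp, (Rabs_pos_eq e), (Rabs_pos_eq (Rpower _ _)) by
    (try lra; apply Rlt_le, Rpower_gt_0).
  apply Rmult_le_compat_l; [lra|].
  replace (- e - 1) with (- (e + 1)) by ring; rewrite !Rpower_Ropp.
  apply Rinv_le_contravar; [apply Rpower_gt_0|].
  apply Rle_Rpower_l; [lra | split; lra]. }
intros r r' hr hr'; destruct (Rtotal_order r r') as [h | [<- | h]].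
- now apply main.
- rewrite !Rminus_diag, Rabs_R0; lra.
- rewrite Rabs_minus_sym, (Rabs_minus_sym r); now apply main.
Qed.

(** This turns uniform convergence of positions that stay away from the origin
    into uniform convergence of accelerations. *)
Lemma force_uniformly_continuous (K e m M eta : R) :
  0 < e -> 0 < m -> 0 < eta ->
  exists d, 0 < d /\ forall x y x' y',
    m <= sqrt (sqdist x y) -> m <= sqrt (sqdist x' y') -> Rabs x' <= M ->
    Rabs (x - x') < d -> Rabs (y - y') < d ->
    Rabs (K / Rpower (sqrt (sqdist x y)) e * x -
          K / Rpower (sqrt (sqdist x' y')) e * x') <= eta.
Proof.
intros he hm heta.
destruct (inv_Rpower_lipschitz e m he hm) as [C [hC hlip]].
set (A := Rabs K * (/ Rpower m e + 2 * C * Rabs M) + 1).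
assert (hmi : 0 < / Rpower m e) by (apply Rinv_0_lt_compat, Rpower_gt_0).
assert (hA : 0 < A).
{ unfold A; assert (h1 := Rabs_pos K); assert (h2 := Rabs_pos M).
  assert (0 <= Rabs K * (/ Rpower m e + 2 * C * Rabs M)); [|lra].
  apply Rmult_le_pos; [lra|]; assert (0 <= 2 * C * Rabs M); [|lra].
  apply Rmult_le_pos; lra. }
exists (eta / A); split; [now apply Rdiv_lt_0_compat|].
intros x y x' y' hr hr' hx' hx hy.
set (r := sqrt (sqdist x y)) in *; set (r' := sqrt (sqdist x' y')) in *.
assert (hrr : Rabs (r - r') <= 2 * (eta / A)).
{ apply Rle_trans with (1 := radius_lipschitz x y x' y'); lra. }
assert (hl := hlip r r' hr hr').
assert (hb : Rabs (/ Rpower r e) <= / Rpower m e).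
{ rewrite Rabs_pos_eq by (apply Rlt_le, Rinv_0_lt_compat, Rpower_gt_0).
  apply Rinv_le_contravar; [apply Rpower_gt_0|].
  apply Rle_Rpower_l; [lra | split; lra]. }
replace (K / Rpower r e * x - K / Rpower r' e * x') with
  (K * (/ Rpower r e * (x - x') + (/ Rpower r e - / Rpower r' e) * x')).
2:{ field; split; apply Rgt_not_eq, Rpower_gt_0. }
rewrite Rabs_mult.
assert (h1 : Rabs (/ Rpower r e * (x - x') + (/ Rpower r e - / Rpower r' e) * x') <=
  (/ Rpower m e + 2 * C * Rabs M) * (eta / A)).
{ apply Rle_trans with (1 := Rabs_triang _ _); rewrite !Rabs_mult.
  assert (hM := Rle_abs M).
  assert (b1 : Rabs (/ Rpower r e) * Rabs (x - x') <= / Rpower m e * (eta / A)).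
  { apply Rmult_le_compat; try apply Rabs_pos; lra. }
  assert (b2 : Rabs (/ Rpower r e - / Rpower r' e) * Rabs x' <=
    (C * (2 * (eta / A))) * Rabs M).
  { apply Rmult_le_compat; try apply Rabs_pos; [|lra].
    apply Rle_trans with (1 := hl); apply Rmult_le_compat_l; lra. }
  lra. }
apply Rle_trans with (1 := Rmult_le_compat_l _ _ _ (Rabs_pos K) h1).
assert (h2 : (A - 1) * (eta / A) <= eta).
{ replace ((A - 1) * (eta / A)) with (eta - eta / A) by (field; lra).
  assert (0 < eta / A) by (now apply Rdiv_lt_0_compat); lra. }
unfold A in h2 at 1; lra.
Qed.

Ltac lra_abs :=
  repeat match goal with
  | H : Rabs _ < _ |- _ => apply Rabs_def2 in H; destruct H
  | H : Rabs _ <= _ |- _ => apply Rabs_le_between in H; destruct H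
  end;
  first [apply Rabs_def1 | apply Rabs_le | idtac]; lra.

Lemma is_lim_seq_sqdist (u v : nat -> R) (l l' : R) :
  is_lim_seq u l -> is_lim_seq v l' -> is_lim_seq (fun n => sqdist (u n) (v n)) (sqdist l l').
Proof.
intros hu hv; unfold sqdist; simpl.
apply is_lim_seq_plus'; (apply is_lim_seq_mult'; [assumption|]);
  (apply is_lim_seq_mult'; [assumption | apply is_lim_seq_const]).
Qed.

Lemma is_lim_seq_radius (u v : nat -> R) (l l' : R) :
  is_lim_seq u l -> is_lim_seq v l' ->
  is_lim_seq (fun n => sqrt (sqdist (u n) (v n))) (sqrt (sqdist l l')).
Proof.
intros hu hv; apply (is_lim_seq_continuous sqrt); [|now apply is_lim_seq_sqdist].
apply continuity_pt_sqrt, sqdist_nonneg.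
Qed.

Lemma atan_ratio_lim (S ell : nat -> R) (sigma : R) :
  0 < sigma -> eventually (fun n => sigma <= S n /\ 0 < ell n) -> is_lim_seq ell 0 ->
  is_lim_seq (fun n => atan (S n / ell n)) (PI / 2).
Proof.
intros hs hev hl.
apply (is_lim_seq_le_le_loc (fun n => PI / 2 - atan (ell n / sigma)) _ (fun _ => PI / 2)).
- generalize hev; apply filter_imp; intros n [h1 h2]; split.
  + assert (hp : 0 < ell n / sigma) by (apply Rdiv_lt_0_compat; lra).
    rewrite <- atan_inv by exact hp.
    replace (/ (ell n / sigma)) with (sigma / ell n) by (field; lra).
    assert (hle : sigma / ell n <= S n / ell n).
    { unfold Rdiv; apply Rmult_le_compat_r; [left; now apply Rinv_0_lt_compat | exact h1]. }
    destruct hle as [hlt | ->]; [left; now apply atan_increasing | right; reflexivity].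
  + left; apply atan_bound.
- assert (e0 : PI / 2 = PI / 2 - atan (0 / sigma)).
  { unfold Rdiv at 3; rewrite Rmult_0_l, atan_0; ring. }
  replace (Finite (PI / 2)) with (Finite (PI / 2 - atan (0 / sigma))) by now rewrite <- e0.
  apply (is_lim_seq_minus' (fun _ => PI / 2)); [apply is_lim_seq_const|].
  apply (is_lim_seq_continuous (fun z => atan (z / sigma))); [|exact hl].
  apply continuity_pt_filterlim,
    (ex_derive_continuous (V := R_NormedModule) (fun z : R => atan (z / sigma))).
  auto_derive; trivial.
- apply is_lim_seq_const.
Qed.

Section Limit.
Context (mu alpha E : R) (ha : 0 < alpha < 2) (hmu : 0 < mu) (a b : Rbar).
Context (x y p w : nat -> R -> R) (xs ys : R -> R).
Context (hsol : forall n, motion mu alpha E (in_oo a b) (x n) (y n) (p n) (w n)).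
Context (hlim : forall l l', in_oo a b l -> in_oo a b l' -> forall eta, 0 < eta ->
  eventually (fun n => forall t, l <= t <= l' ->
    Rabs (x n t - xs t) < eta /\ Rabs (y n t - ys t) < eta)).

Lemma limit_pointwise (t : R) : in_oo a b t ->
  is_lim_seq (fun n => x n t) (xs t) /\ is_lim_seq (fun n => y n t) (ys t).
Proof.
intros ht; split; apply is_lim_seq_eps; intros e he;
  generalize (hlim t t ht ht e he); apply filter_imp; intros n h; apply h; lra.
Qed.

Lemma limit_near (t : R) (eta : R) : in_oo a b t -> 0 < eta ->
  exists d, 0 < d /\ (forall s, t - d <= s <= t + d -> in_oo a b s) /\
    (forall s, t - d <= s <= t + d -> Rabs (xs s - xs t) < eta /\ Rabs (ys s - ys t) < eta).
Proof.
intros ht heta.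
destruct (in_oo_neighbourhood a b t ht) as [d [hd hD]].
assert (he : 0 < eta / 3) by lra.
destruct (hlim (t - d) (t + d) (hD (t - d) ltac:(lra)) (hD (t + d) ltac:(lra)) _ he) as [n hn].
specialize (hn n (Nat.le_refl n)).
assert (ct : forall f f' : R -> R, is_derive f t (f' t) ->
  locally t (fun s => Rabs (f s - f t) < eta / 3)).
{ intros f f' hf.
  assert (hc : continuous f t) by (apply (ex_derive_continuous (V := R_NormedModule)); now exists (f' t)).
  exact (proj1 (filterlim_locally f (f t)) hc (mkposreal _ he)). }
destruct (hsol n t ht) as [_ [hx [hy _]]].
destruct (filter_and _ _ (ct _ (p n) hx) (ct _ (w n) hy)) as [[d' hd'] h].
assert (h1 := Rmin_l d (d' / 2)); assert (h2 := Rmin_r d (d' / 2)).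
assert (h3 : 0 < Rmin d (d' / 2)) by (apply Rmin_pos; lra).
exists (Rmin d (d' / 2)); split; [exact h3 | split]; intros s hs.
- apply hD; lra.
- destruct (h s) as [hsx hsy].
  { change (Rabs (s - t) < d'); lra_abs. }
  destruct (hn s ltac:(lra)) as [nx ny]; destruct (hn t ltac:(lra)) as [mx my].
  split; lra_abs.
Qed.

Lemma limit_continuous (t : R) : in_oo a b t -> continuous xs t /\ continuous ys t.
Proof.
intros ht; split; apply filterlim_locally; intros [e he];
  destruct (limit_near t e ht he) as [d [hd [_ h]]]; exists (mkposreal d hd);
  intros s hs; change (Rabs (s - t) < d) in hs; apply (h s); lra_abs.
Qed.

Lemma limit_force_continuous (K e t : R) : in_oo a b t -> 0 < sqdist (xs t) (ys t) ->
  continuous (fun s => K / Rpower (sqrt (sqdist (xs s) (ys s))) e * xs s) t /\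
  continuous (fun s => K / Rpower (sqrt (sqdist (xs s) (ys s))) e * ys s) t.
Proof.
intros ht hN; destruct (limit_continuous t ht) as [cx cy].
assert (hr := sqrt_lt_R0 _ hN).
assert (ck : continuous (fun s => K / Rpower (sqrt (sqdist (xs s) (ys s))) e) t).
{ apply (continuous_comp (fun s => sqdist (xs s) (ys s)) (fun z => K / Rpower (sqrt z) e)).
  - apply (continuous_plus (V := R_NormedModule) (fun s => xs s ^ 2) (fun s => ys s ^ 2));
      [apply (continuous_comp xs (fun z => z ^ 2)) | apply (continuous_comp ys (fun z => z ^ 2))];
      try assumption; apply (ex_derive_continuous (V := R_NormedModule)); auto_derive; trivial.
  - apply (ex_derive_continuous (V := R_NormedModule)); unfold Rpower; auto_derive.
    repeat split; auto; apply Rgt_not_eq, exp_pos. }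
split; apply (continuous_mult (K := R_AbsRing)); assumption.
Qed.

(** Near [t] the approximating solutions stay away from the origin as well, so
    their accelerations converge uniformly and [limit_second_derivative] applies
    to both coordinates. *)
Lemma limit_newton_near (t : R) : in_oo a b t -> 0 < sqdist (xs t) (ys t) ->
  exists d, 0 < d /\ forall s, t - d < s < t + d ->
    is_derive xs s (Derive xs s) /\ is_derive ys s (Derive ys s) /\
    is_derive (Derive xs) s (- (mu * alpha) /
      Rpower (sqrt (sqdist (xs s) (ys s))) (alpha + 2) * xs s) /\
    is_derive (Derive ys) s (- (mu * alpha) /
      Rpower (sqrt (sqdist (xs s) (ys s))) (alpha + 2) * ys s) /\
    is_lim_seq (fun n => p n s) (Derive xs s) /\ is_lim_seq (fun n => w n s) (Derive ys s).
Proof.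
intros ht hN; set (r := sqrt (sqdist (xs t) (ys t))).
assert (hr : 0 < r) by (now apply sqrt_lt_R0).
destruct (limit_near t (r / 8) ht) as [d [hd [hD hs]]]; [lra|].
assert (hmin : forall s, t - d <= s <= t + d -> r / 2 <= sqrt (sqdist (xs s) (ys s))).
{ intros s h; destruct (hs s h) as [h1 h2].
  assert (h3 := radius_lipschitz (xs s) (ys s) (xs t) (ys t)); fold r in h3.
  apply Rabs_le_between in h3; lra. }
set (M := Rabs (xs t) + Rabs (ys t) + r).
assert (hM : forall s, t - d <= s <= t + d -> Rabs (xs s) <= M /\ Rabs (ys s) <= M).
{ intros s h; destruct (hs s h) as [h1 h2]; unfold M; split; split_Rabs; lra. }
set (h := fun s => - (mu * alpha) / Rpower (sqrt (sqdist (xs s) (ys s))) (alpha + 2)).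
assert (unif : forall eta, 0 < eta -> eventually (fun n => forall s, t - d <= s <= t + d ->
  Rabs (- (mu * alpha) / Rpower (sqrt (sqdist (x n s) (y n s))) (alpha + 2) * x n s
    - h s * xs s) <= eta /\
  Rabs (- (mu * alpha) / Rpower (sqrt (sqdist (x n s) (y n s))) (alpha + 2) * y n s
    - h s * ys s) <= eta)).
{ intros eta heta.
  destruct (force_uniformly_continuous (- (mu * alpha)) (alpha + 2) (r / 4) M eta)
    as [e [he hF]]; try lra.
  assert (he' : 0 < Rmin e (r / 8)) by (apply Rmin_pos; lra).
  assert (m1 := Rmin_l e (r / 8)); assert (m2 := Rmin_r e (r / 8)).
  generalize (hlim (t - d) (t + d) (hD (t - d) ltac:(lra)) (hD (t + d) ltac:(lra)) _ he').
  apply filter_imp; intros n hn s hs'; specialize (hn s hs'); destruct hn as [hx hy].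
  assert (hrn : r / 4 <= sqrt (sqdist (x n s) (y n s))).
  { assert (h3 := radius_lipschitz (x n s) (y n s) (xs s) (ys s)).
    assert (h4 := hmin s hs'); apply Rabs_le_between in h3; lra. }
  assert (h4 := hmin s hs'); assert (hMs := hM s hs').
  assert (comm : forall u v, sqdist u v = sqdist v u) by (intros; unfold sqdist; ring).
  split; [apply hF | unfold h; rewrite (comm (x n s)), (comm (xs s)) in *; apply hF]; lra. }
assert (hcont : forall s, t - d <= s <= t + d ->
  continuous (fun s => h s * xs s) s /\ continuous (fun s => h s * ys s) s).
{ intros s h'; apply (limit_force_continuous (- (mu * alpha)) (alpha + 2) s); [now apply hD|].
  apply sqrt_lt_0_alt; rewrite sqrt_0; specialize (hmin s h'); lra. }
destruct (limit_second_derivative x p (fun n s => - (mu * alpha) /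
    Rpower (sqrt (sqdist (x n s) (y n s))) (alpha + 2) * x n s) xs
    (fun s => h s * xs s) (t - d) (t + d)) as [p1 [hx1 [hx2 hx3]]].
{ lra. }
{ intros n s h'; apply (hsol n s (hD s h')). }
{ intros n s h'; apply (hsol n s (hD s h')). }
{ intros s h'; exact (proj1 (limit_pointwise s (hD s h'))). }
{ intros eta heta; generalize (unif eta heta); apply filter_imp; intros n hn s h'; now apply hn. }
{ intros s h'; exact (proj1 (hcont s h')). }
destruct (limit_second_derivative y w (fun n s => - (mu * alpha) /
    Rpower (sqrt (sqdist (x n s) (y n s))) (alpha + 2) * y n s) ys
    (fun s => h s * ys s) (t - d) (t + d)) as [w1 [hy1 [hy2 hy3]]].
{ lra. }
{ intros n s h'; apply (hsol n s (hD s h')). }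
{ intros n s h'; apply (hsol n s (hD s h')). }
{ intros s h'; exact (proj2 (limit_pointwise s (hD s h'))). }
{ intros eta heta; generalize (unif eta heta); apply filter_imp; intros n hn s h'; now apply hn. }
{ intros s h'; exact (proj2 (hcont s h')). }
assert (ep : forall s, t - d < s < t + d -> p1 s = Derive xs s).
{ intros s h'; symmetry; apply is_derive_unique; now apply hx1. }
assert (ew : forall s, t - d < s < t + d -> w1 s = Derive ys s).
{ intros s h'; symmetry; apply is_derive_unique; now apply hy1. }
assert (near : forall s, t - d < s < t + d -> locally s (fun v => t - d < v < t + d)).
{ intros s h'; apply filter_and; [apply (open_gt (t - d)) | apply (open_lt (t + d))]; lra. }
exists d; split; [exact hd|]; intros s h'.
rewrite <- (ep s h'), <- (ew s h').
split; [now apply hx1 | split; [now apply hy1|]].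
split; [apply (is_derive_ext_loc p1 (Derive xs)); [|now apply hx2] |
  split; [apply (is_derive_ext_loc w1 (Derive ys)); [|now apply hy2] | split; [now apply hx3 | now apply hy3]]].
- generalize (near s h'); apply filter_imp; exact ep.
- generalize (near s h'); apply filter_imp; exact ew.
Qed.

Lemma limit_velocity (t : R) : in_oo a b t -> 0 < sqdist (xs t) (ys t) ->
  is_lim_seq (fun n => p n t) (Derive xs t) /\ is_lim_seq (fun n => w n t) (Derive ys t).
Proof.
intros ht hN; destruct (limit_newton_near t ht hN) as [d [hd h]].
split; apply (h t); lra.
Qed.

Lemma limit_motion :
  motion mu alpha E (fun t => in_oo a b t /\ 0 < sqdist (xs t) (ys t)) xs ys (Derive xs) (Derive ys).
Proof.
intros t [ht hN]; destruct (limit_newton_near t ht hN) as [d [hd h]].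
destruct (h t ltac:(lra)) as [h1 [h2 [h3 [h4 [h5 h6]]]]].
split; [exact hN | split; [exact h1 | split; [exact h2 | split; [exact h3 | split; [exact h4|]]]]].
destruct (limit_pointwise t ht) as [lx ly].
assert (hr := sqrt_lt_R0 _ hN).
assert (cU : continuity_pt (fun z => mu / Rpower z alpha) (sqrt (sqdist (xs t) (ys t)))).
{ apply continuity_pt_filterlim,
    (ex_derive_continuous (V := R_NormedModule) (fun z : R => mu / Rpower z alpha)).
  unfold Rpower; auto_derive; repeat split; auto; apply Rgt_not_eq, exp_pos. }
assert (hE : is_lim_seq (fun n => 1 / 2 * sqdist (p n t) (w n t) -
    mu / Rpower (sqrt (sqdist (x n t) (y n t))) alpha)
  (1 / 2 * sqdist (Derive xs t) (Derive ys t) - mu / Rpower (sqrt (sqdist (xs t) (ys t))) alpha)).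
{ apply is_lim_seq_minus'.
  - apply is_lim_seq_mult'; [apply is_lim_seq_const | now apply is_lim_seq_sqdist].
  - apply (is_lim_seq_continuous (fun z => mu / Rpower z alpha)); [exact cU|].
    now apply is_lim_seq_radius. }
apply is_lim_seq_unique in hE.
rewrite (Lim_seq_ext _ (fun _ => E)), Lim_seq_const in hE by
  (intros n; apply (hsol n t ht)).
now injection hE.
Qed.

(** * Collisions *)

Lemma momentum_const (n : nat) (s t : R) : in_oo a b s -> in_oo a b t ->
  momentum (x n s) (y n s) (p n s) (w n s) = momentum (x n t) (y n t) (p n t) (w n t).
Proof.
intros hs ht; destruct (Rle_dec s t) as [h | h]; [|symmetry];
  apply (motion_momentum_const _ _ _ _ _ _ _ _ _ _ (hsol n)); try lra;
  intros r; now apply in_oo_segment.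
Qed.

Lemma sqdist_second_derive (n : nat) (s : R) : in_oo a b s ->
  is_derive (fun t => sqdist (x n t) (y n t)) s (2 * virial (x n s) (y n s) (p n s) (w n s)) /\
  is_derive (fun t => 2 * virial (x n t) (y n t) (p n t) (w n t)) s
    (2 * lagrange_jacobi mu alpha E (sqrt (sqdist (x n s) (y n s)))).
Proof.
intros hs; split; [now apply (motion_sqdist_derive _ _ _ _ _ _ _ _ (hsol n))|].
apply is_derive_scal; now apply (motion_virial_derive _ _ _ _ _ _ _ _ (hsol n)).
Qed.

Lemma direction_lim (t : R) : in_oo a b t -> 0 < sqdist (xs t) (ys t) ->
  is_lim_seq (fun n => x n t / sqrt (sqdist (x n t) (y n t))) (xs t / sqrt (sqdist (xs t) (ys t))) /\
  is_lim_seq (fun n => y n t / sqrt (sqdist (x n t) (y n t))) (ys t / sqrt (sqdist (xs t) (ys t))).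
Proof.
intros ht hN; destruct (limit_pointwise t ht) as [lx ly].
assert (lr := is_lim_seq_radius _ _ _ _ lx ly); assert (hr := sqrt_lt_R0 _ hN).
split; apply is_lim_seq_div'; auto; lra.
Qed.

Section Collision.
Context (t0 : R) (ht0 : in_oo a b t0) (hx0 : xs t0 = 0) (hy0 : ys t0 = 0).

(** At distance [r] the squared momentum is at most
    [r^2 |v|^2 = 2 E r^2 + 2 mu r^(2 - alpha)], and [alpha < 2]: solutions that
    come close to the origin have small angular momentum. *)
Lemma momentum_vanishes (t : R) : in_oo a b t ->
  is_lim_seq (fun n => momentum (x n t) (y n t) (p n t) (w n t)) 0.
Proof.
intros ht.
apply (is_lim_seq_ext (fun n => momentum (x n t0) (y n t0) (p n t0) (w n t0))).
{ intros n; now apply momentum_const. }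
assert (lr : is_lim_seq (fun n => sqrt (sqdist (x n t0) (y n t0))) 0).
{ destruct (limit_pointwise t0 ht0) as [lx ly].
  assert (l := is_lim_seq_radius _ _ _ _ lx ly); rewrite hx0, hy0 in l.
  replace (sqrt (sqdist 0 0)) with 0 in l; [exact l|].
  unfold sqdist; replace (0 ^ 2 + 0 ^ 2) with 0 by ring; symmetry; apply sqrt_0. }
apply is_lim_seq_eps; intros e he.
set (B := 2 * Rabs E + 2 * mu + 1).
assert (hB : 1 < B) by (unfold B; generalize (Rabs_pos E); lra).
assert (heta : 0 < e ^ 2 / B) by (apply Rdiv_lt_0_compat; nra).
destruct (Rpower_small (2 - alpha) (e ^ 2 / B)) as [rho [hrho hs]]; [lra | exact heta |].
assert (hmin : 0 < Rmin rho (Rmin 1 (e ^ 2 / B))) by (repeat apply Rmin_pos; lra).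
generalize (is_lim_seq_eventually _ _ _ lr hmin); apply filter_imp; intros n hn.
destruct (hsol n t0 ht0) as [hN [_ [_ [_ [_ he']]]]].
assert (hi := virial_momentum_sq (x n t0) (y n t0) (p n t0) (w n t0)).
set (N := sqdist (x n t0) (y n t0)) in *; set (L := momentum _ _ _ _) in *.
set (V := sqdist (p n t0) (w n t0)) in *.
assert (hr := sqrt_lt_R0 _ hN); assert (er : sqrt N ^ 2 = N) by (apply pow2_sqrt; lra).
set (r := sqrt N) in *; rewrite Rminus_0_r, Rabs_pos_eq in hn by lra.
assert (h1 := Rmin_l rho (Rmin 1 (e ^ 2 / B))); assert (h2 := Rmin_r rho (Rmin 1 (e ^ 2 / B))).
assert (h3 := Rmin_l 1 (e ^ 2 / B)); assert (h4 := Rmin_r 1 (e ^ 2 / B)).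
specialize (hs r ltac:(lra)).
assert (hpow : Rpower r (2 - alpha) = N / Rpower r alpha).
{ unfold Rminus; rewrite Rplus_comm, Rpower_plus_2, Rpower_Ropp, er by lra.
  unfold Rdiv; ring. }
assert (hNV : N * V = 2 * E * N + 2 * mu * Rpower r (2 - alpha)).
{ rewrite hpow; replace V with (2 * (E + mu / Rpower r alpha)) by lra.
  field; apply Rgt_not_eq, Rpower_gt_0. }
assert (hN1 : N <= e ^ 2 / B) by (rewrite <- er; nra).
assert (hE : E * N <= Rabs E * (e ^ 2 / B)).
{ generalize (Rle_abs E) (Rabs_pos E); nra. }
assert (hfin : (B - 1) * (e ^ 2 / B) < e ^ 2).
{ replace ((B - 1) * (e ^ 2 / B)) with (e ^ 2 - e ^ 2 / B) by (field; lra); lra. }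
assert (hL2 : L ^ 2 < e ^ 2).
{ apply Rle_lt_trans with (2 := hfin); unfold B at 1.
  assert (0 <= virial (x n t0) (y n t0) (p n t0) (w n t0) ^ 2) by apply pow2_ge_0.
  nra. }
rewrite Rminus_0_r; apply Rabs_def1; nra.
Qed.

(** The interval does not depend on [n]: the limit is close to the origin on it,
    and convergence is uniform. *)
Lemma near_collision
 (K : R) : exists d, 0 < d /\
  (forall s, t0 - d <= s <= t0 + d -> in_oo a b s) /\
  eventually (fun n => forall s, t0 - d <= s <= t0 + d ->
    K <= lagrange_jacobi mu alpha E (sqrt (sqdist (x n s) (y n s)))).
Proof.
destruct (lagrange_jacobi_large mu alpha E K ha hmu) as [rho [hrho hJ]].
destruct (limit_near t0 (rho / 4) ht0) as [d [hd [hD hs]]]; [lra|].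
exists d; split; [exact hd | split; [exact hD|]].
assert (he : 0 < rho / 4) by lra.
generalize (hlim (t0 - d) (t0 + d) (hD (t0 - d) ltac:(lra)) (hD (t0 + d) ltac:(lra)) _ he).
apply filter_imp; intros n hn s h; apply hJ.
destruct (hs s h) as [h1 h2]; destruct (hn s h) as [h3 h4].
split; [apply sqrt_lt_R0, (hsol n s (hD s h))|].
assert (h5 := radius_lipschitz (x n s) (y n s) (xs t0) (ys t0)).
replace (sqrt (sqdist (xs t0) (ys t0))) with 0 in h5.
2:{ rewrite hx0, hy0; unfold sqdist; replace (0 ^ 2 + 0 ^ 2) with 0 by ring; now rewrite sqrt_0. }
assert (h6 : Rabs (x n s - xs t0) < rho / 2) by lra_abs.
assert (h7 : Rabs (y n s - ys t0) < rho / 2) by lra_abs.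
apply Rabs_le_between in h5; lra.
Qed.

(** Near a collision the squared distance along the approximating solutions is
    uniformly convex.  The limit inherits this across the collision, where it
    satisfies no differential equation: so collisions are isolated, and the
    distance increases away from them. *)
Lemma collision_convex : exists d, 0 < d /\
  (forall s, t0 - d <= s <= t0 + d -> in_oo a b s) /\
  (forall s, t0 - d <= s <= t0 + d -> (s - t0) ^ 2 <= sqdist (xs s) (ys s)) /\
  (forall s m, t0 - d <= s <= t0 + d -> 0 <= m <= 1 ->
    sqdist (xs (t0 + m * (s - t0))) (ys (t0 + m * (s - t0))) <= m * sqdist (xs s) (ys s)).
Proof.
(* [lagrange_jacobi] being at least 1, the squared distance has second
   derivative at least 2, which is that of [(t - t0) ^ 2] *)
destruct (near_collision 1) as [d [hd [hD hJ]]].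
assert (hconv : convex_between (fun t => sqdist (xs t) (ys t) - (t - t0) ^ 2) (t0 - d) (t0 + d)).
{ apply (convex_between_lim (fun n t => sqdist (x n t) (y n t) - (t - t0) ^ 2)); [lra | |].
  - intros t ht; apply is_lim_seq_minus'; [|apply is_lim_seq_const].
    apply is_lim_seq_sqdist; now apply (limit_pointwise), hD.
  - generalize hJ; apply filter_imp; intros n hn.
    apply second_derive_convex with
      (f1 := fun t => 2 * virial (x n t) (y n t) (p n t) (w n t) - 2 * (t - t0))
      (f2 := fun t => 2 * lagrange_jacobi mu alpha E (sqrt (sqdist (x n t) (y n t))) - 2).
    + intros t ht; apply (is_derive_minus (V := R_NormedModule)).
      * now apply sqdist_second_derive, hD.
      * auto_derive; [trivial | ring].
    + intros t ht; apply (is_derive_minus (V := R_NormedModule)).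
      * now apply sqdist_second_derive, hD.
      * auto_derive; [trivial | ring].
    + intros t ht; specialize (hn t ht); lra. }
assert (hchord : forall s m, t0 - d <= s <= t0 + d -> 0 <= m <= 1 ->
  sqdist (xs (t0 + m * (s - t0))) (ys (t0 + m * (s - t0))) - (m * (s - t0)) ^ 2 <=
  m * (sqdist (xs s) (ys s) - (s - t0) ^ 2)).
{ intros s m hs hm; assert (h := hconv t0 s m ltac:(lra) hs hm); cbv beta in h.
  rewrite hx0, hy0 in h; unfold sqdist at 2 in h.
  replace (t0 + m * (s - t0) - t0) with (m * (s - t0)) in h by ring; lra. }
exists d; split; [exact hd | split; [exact hD | split]].
- intros s hs; apply Rnot_lt_le; intros hlt.
  (* the chord inequality at a small barycentric coordinate [m] would make the
     squared distance negative *)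
  set (k := sqdist (xs s) (ys s) - (s - t0) ^ 2) in *.
  assert (hk : k < 0) by (unfold k; lra).
  assert (hp : 0 <= (s - t0) ^ 2) by apply pow2_ge_0.
  set (m := - k / ((s - t0) ^ 2 - k + 1)).
  assert (hm : 0 < m <= 1).
  { unfold m; split; [apply Rdiv_lt_0_compat; lra | apply Rle_div_l; lra]. }
  assert (em : m * ((s - t0) ^ 2 - k + 1) = - k) by (unfold m; field; lra).
  assert (h := hchord s m hs ltac:(lra)); fold k in h.
  assert (hn := sqdist_nonneg (xs (t0 + m * (s - t0))) (ys (t0 + m * (s - t0)))).
  rewrite Rpow_mult_distr in h; nra.
- intros s m hs hm; assert (h := hchord s m hs hm).
  assert (hp : 0 <= m * (1 - m) * (s - t0) ^ 2).
  { apply Rmult_le_pos; [apply Rmult_le_pos; lra | apply pow2_ge_0]. }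
  rewrite Rpow_mult_distr in h; lra.
Qed.

(** The collision at [t0] forces this at all times, because the approximating
    momenta are constant in time. *)
Lemma limit_momentum_zero (t : R) : in_oo a b t -> 0 < sqdist (xs t) (ys t) ->
  momentum (xs t) (ys t) (Derive xs t) (Derive ys t) = 0.
Proof.
intros ht hN.
destruct (limit_pointwise t ht) as [lx ly].
destruct (limit_velocity t ht hN) as [lp lw].
assert (l1 : is_lim_seq (fun n => momentum (x n t) (y n t) (p n t) (w n t))
  (momentum (xs t) (ys t) (Derive xs t) (Derive ys t))).
{ apply is_lim_seq_minus'; now apply is_lim_seq_mult'. }
apply is_lim_seq_unique in l1; rewrite (is_lim_seq_unique _ _ (momentum_vanishes t ht)) in l1.
now injection l1.
Qed.

(** * Turning at a collision *)

(** Along the approximating solutions the virial is negative before the close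
    encounter and positive after it, by convexity of the squared distance.
    Between the two it vanishes while the kinetic energy is large, so the
    momentum cannot vanish: this rules out radial approximations. *)
Lemma virial_signs (d : R) : 0 < d ->
  (forall s, t0 - d <= s <= t0 + d -> in_oo a b s) ->
  (forall s, t0 - d <= s <= t0 + d -> (s - t0) ^ 2 <= sqdist (xs s) (ys s)) ->
  eventually (fun n => forall s, t0 - d <= s <= t0 + d ->
    1 <= lagrange_jacobi mu alpha E (sqrt (sqdist (x n s) (y n s)))) ->
  eventually (fun n =>
    d / 8 <= virial (x n (t0 + d)) (y n (t0 + d)) (p n (t0 + d)) (w n (t0 + d)) /\
    d / 8 <= - virial (x n (t0 - d)) (y n (t0 - d)) (p n (t0 - d)) (w n (t0 - d)) /\
    momentum (x n t0) (y n t0) (p n t0) (w n t0) <> 0).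
Proof.
intros hd hD hgrow hJ.
assert (hd2 : 0 < d ^ 2 / 4) by nra.
assert (lN : forall s, t0 - d <= s <= t0 + d -> eventually (fun n =>
  Rabs (sqdist (x n s) (y n s) - sqdist (xs s) (ys s)) < d ^ 2 / 4)).
{ intros s hs; apply is_lim_seq_eventually; [|exact hd2].
  apply is_lim_seq_sqdist; now apply (limit_pointwise), hD. }
assert (i0 : t0 - d <= t0 <= t0 + d) by lra.
assert (ip : t0 - d <= t0 + d <= t0 + d) by lra.
assert (im : t0 - d <= t0 - d <= t0 + d) by lra.
generalize (filter_and _ _ hJ (filter_and _ _ (lN _ i0) (filter_and _ _ (lN _ ip) (lN _ im)))).
apply filter_imp; intros n [hJn [h0 [hp hm]]].
assert (gp := hgrow _ ip); assert (gm := hgrow _ im).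
rewrite hx0, hy0 in h0; replace (sqdist 0 0) with 0 in h0 by (unfold sqdist; ring).
replace (t0 + d - t0) with d in gp by ring.
replace ((t0 - d - t0) ^ 2) with (d ^ 2) in gm by ring.
apply Rabs_def2 in h0; apply Rabs_def2 in hp; apply Rabs_def2 in hm.
assert (tangent : forall s, t0 - d <= s <= t0 + d ->
  sqdist (x n s) (y n s) + 2 * virial (x n s) (y n s) (p n s) (w n s) * (t0 - s) <=
  sqdist (x n t0) (y n t0)).
{ intros s hs.
  apply (second_derive_above_tangent (fun t => sqdist (x n t) (y n t))
    (fun t => 2 * virial (x n t) (y n t) (p n t) (w n t))
    (fun t => 2 * lagrange_jacobi mu alpha E (sqrt (sqdist (x n t) (y n t)))) (t0 - d) (t0 + d)); auto.
  - intros t ht; now apply (sqdist_second_derive n t (hD t ht)).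
  - intros t ht; now apply (sqdist_second_derive n t (hD t ht)).
  - intros t ht; specialize (hJn t ht); lra. }
assert (tp := tangent _ ip); assert (tm := tangent _ im).
set (Sp := virial (x n (t0 + d)) _ _ _) in *; set (Sm := virial (x n (t0 - d)) _ _ _) in *.
assert (hSp : d / 8 <= Sp) by nra.
assert (hSm : d / 8 <= - Sm) by nra.
split; [exact hSp | split; [exact hSm|]]; intros hL.
destruct (Ranalysis5.IVT_interv (fun t => virial (x n t) (y n t) (p n t) (w n t)) (t0 - d) (t0 + d))
  as [z [hz ez]]; [| lra | fold Sm; lra | fold Sp; lra |].
{ intros t ht; apply continuity_pt_filterlim, (ex_derive_continuous (V := R_NormedModule)
    (fun t => virial (x n t) (y n t) (p n t) (w n t))).
  eexists; apply (motion_virial_derive _ _ _ _ _ _ _ _ (hsol n) t (hD t ht)). }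
destruct (hsol n z (hD z hz)) as [hN _].
assert (hV := motion_speed _ _ _ _ _ _ _ _ (hsol n) z (hD z hz)).
assert (hi := virial_momentum_sq (x n z) (y n z) (p n z) (w n z)).
rewrite ez, (momentum_const n z t0 (hD z hz) ht0), hL in hi.
assert (hmp : 0 < mu * alpha / Rpower (sqrt (sqdist (x n z) (y n z))) alpha).
{ apply Rdiv_lt_0_compat; [nra | apply Rpower_gt_0]. }
specialize (hJn z hz); nra.
Qed.

(** One of the two orientations is nearly attained.  For an approximating
    solution the sign of its momentum decides which, and [turning_estimate]
    bounds the gap by [2 (kappa PI)^2], a contribution from each coordinate; the
    third [(kappa PI)^2] is spent on passing to the limit.  The sign may depend
    on the solution, so the limit only yields a disjunction. *)
Lemma turning_gap (d kappa : R) : 0 < d -> 0 < kappa ->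
  (forall s, t0 - d <= s <= t0 + d -> in_oo a b s) ->
  (forall s, t0 - d <= s <= t0 + d -> (s - t0) ^ 2 <= sqdist (xs s) (ys s)) ->
  eventually (fun n => forall s, t0 - d <= s <= t0 + d ->
    Rmax 1 (alpha * Rabs E / ((1 - alpha / 2) * kappa)) <=
    lagrange_jacobi mu alpha E (sqrt (sqdist (x n s) (y n s)))) ->
  let gap := fun s =>
    rot_gap (s * (PI / 2 / (1 - alpha / 2)))
      (xs (t0 + d) / sqrt (sqdist (xs (t0 + d)) (ys (t0 + d))))
      (ys (t0 + d) / sqrt (sqdist (xs (t0 + d)) (ys (t0 + d))))
      (xs (t0 - d) / sqrt (sqdist (xs (t0 - d)) (ys (t0 - d))))
      (ys (t0 - d) / sqrt (sqdist (xs (t0 - d)) (ys (t0 - d)))) in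
  gap 1 <= 3 * (kappa * PI) ^ 2 \/ gap (-1) <= 3 * (kappa * PI) ^ 2.
Proof.
intros hd hk hD hgrow hJ gap.
set (c := 1 - alpha / 2) in *; assert (hc : 0 < c) by (unfold c; lra).
set (tp := t0 + d) in *; set (tm := t0 - d) in *.
assert (ip : tm <= tp <= tp) by (unfold tp, tm; lra).
assert (im : tm <= tm <= tp) by (unfold tp, tm; lra).
assert (hNp : 0 < sqdist (xs tp) (ys tp)).
{ assert (h := hgrow _ ip); replace (tp - t0) with d in h by (unfold tp; ring); nra. }
assert (hNm : 0 < sqdist (xs tm) (ys tm)).
{ assert (h := hgrow _ im); replace (tm - t0) with (- d) in h by (unfold tm; ring); nra. }
assert (hJ1 : eventually (fun n => forall s, tm <= s <= tp ->
    1 <= lagrange_jacobi mu alpha E (sqrt (sqdist (x n s) (y n s))))).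
{ generalize hJ; apply filter_imp; intros n hn s hs.
  apply Rle_trans with (1 := Rmax_l _ _) (2 := hn s hs). }
assert (hsign := virial_signs d hd hD hgrow hJ1); fold tp tm in hsign.
set (S := fun t n => virial (x n t) (y n t) (p n t) (w n t)).
set (L := fun n => momentum (x n t0) (y n t0) (p n t0) (w n t0)).
assert (lL : is_lim_seq (fun n => Rabs (L n)) 0).
{ rewrite <- Rabs_R0; apply (is_lim_seq_abs L 0).
  exact (momentum_vanishes t0 ht0). }
assert (gp : is_lim_seq (fun n => atan (S tp n / Rabs (L n))) (PI / 2)).
{ apply (atan_ratio_lim _ _ (d / 8)); [lra | | exact lL].
  generalize hsign; apply filter_imp; intros n [h1 [_ h3]]; split; [exact h1 | now apply Rabs_pos_lt]. }
assert (gm : is_lim_seq (fun n => atan (S tm n / Rabs (L n))) (- (PI / 2))).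
{ apply (is_lim_seq_ext (fun n => - atan (- S tm n / Rabs (L n)))).
  { intros n; unfold Rdiv; rewrite Ropp_mult_distr_l_reverse, atan_opp; ring. }
  apply (is_lim_seq_opp _ (PI / 2)), (atan_ratio_lim _ _ (d / 8)); [lra | | exact lL].
  generalize hsign; apply filter_imp; intros n [_ [h2 h3]]; split; [exact h2 | now apply Rabs_pos_lt]. }
destruct (direction_lim tp (hD _ ip) hNp) as [lup lvp].
destruct (direction_lim tm (hD _ im) hNm) as [lum lvm].
set (W := fun rot s t n => rot (s * (atan (S t n / Rabs (L n)) / c))
  (x n t / sqrt (sqdist (x n t) (y n t))) (y n t / sqrt (sqdist (x n t) (y n t))) : R).
assert (lgap : forall s, is_lim_seq (fun n =>
  sqdist (W rotx s tp n - W rotx s tm n) (W roty s tp n - W roty s tm n)) (gap s)).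
{ intros s.
  assert (lpp : is_lim_seq (fun n => s * (atan (S tp n / Rabs (L n)) / c)) (s * (PI / 2 / c))).
  { apply is_lim_seq_mult'; [apply is_lim_seq_const|].
    apply is_lim_seq_div'; [exact gp | apply is_lim_seq_const | lra]. }
  assert (lpm : is_lim_seq (fun n => s * (atan (S tm n / Rabs (L n)) / c)) (- (s * (PI / 2 / c)))).
  { replace (- (s * (PI / 2 / c))) with (s * (- (PI / 2) / c)) by (field; lra).
    apply is_lim_seq_mult'; [apply is_lim_seq_const|].
    apply is_lim_seq_div'; [exact gm | apply is_lim_seq_const | lra]. }
  destruct (is_lim_seq_rot _ _ _ _ _ _ lpp lup lvp) as [r1 r2].
  destruct (is_lim_seq_rot _ _ _ _ _ _ lpm lum lvm) as [r3 r4].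
  apply is_lim_seq_sqdist; apply is_lim_seq_minus'; assumption. }
assert (hpi := PI_RGT_0).
assert (hkp : 0 < (kappa * PI) ^ 2) by (assert (0 < kappa * PI) by nra; nra).
assert (hev := filter_and _ _ (is_lim_seq_eventually _ _ _ (lgap 1) hkp)
  (is_lim_seq_eventually _ _ _ (lgap (-1)) hkp)).
destruct (filter_and _ _ hev (filter_and _ _ hsign hJ)) as [n hn].
destruct (hn n (Nat.le_refl n)) as [[g1 g2] [[s1 [s2 s3]] hJn]].
assert (hDL : forall t, tm <= t <= tp -> momentum (x n t) (y n t) (p n t) (w n t) = L n).
{ intros t ht; exact (momentum_const n t t0 (hD t ht) ht0). }
assert (key : forall s, s = 1 \/ s = -1 -> L n = s * Rabs (L n) ->
  sqdist (W rotx s tp n - W rotx s tm n) (W roty s tp n - W roty s tm n) <= 2 * (kappa * PI) ^ 2).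
{ intros s hs hL.
  destruct (turning_estimate mu alpha E (x n) (y n) (p n) (w n) tm tp s (Rabs (L n)) kappa)
    as [e1 e2]; auto; try lra.
  { now apply Rabs_pos_lt. }
  { intros t ht; apply hsol, hD, ht. }
  { intros t ht; rewrite <- hL; now apply hDL. }
  change (Rabs (W rotx s tp n - W rotx s tm n) <=
    kappa * (atan (S tp n / Rabs (L n)) - atan (S tm n / Rabs (L n)))) in e1.
  change (Rabs (W roty s tp n - W roty s tm n) <=
    kappa * (atan (S tp n / Rabs (L n)) - atan (S tm n / Rabs (L n)))) in e2.
  assert (b1 := atan_bound (S tp n / Rabs (L n))); assert (b2 := atan_bound (S tm n / Rabs (L n))).
  assert (b3 : kappa * (atan (S tp n / Rabs (L n)) - atan (S tm n / Rabs (L n))) <= kappa * PI) by nra.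
  unfold sqdist.
  assert (sq : forall z, Rabs z <= kappa * PI -> z ^ 2 <= (kappa * PI) ^ 2).
  { intros z hz; apply Rabs_le_between in hz; nra. }
  generalize (sq _ (Rle_trans _ _ _ e1 b3)) (sq _ (Rle_trans _ _ _ e2 b3)); lra. }
apply Rabs_def2 in g1; apply Rabs_def2 in g2.
destruct (Rle_dec 0 (L n)) as [h | h].
- left; generalize (key 1 (or_introl eq_refl)); rewrite Rabs_pos_eq by lra; intros k; lra.
- right; generalize (key (-1) (or_intror eq_refl)); rewrite Rabs_left by lra; intros k; lra.
Qed.

End Collision.

(** * Rays, turning angle and straight motion of the limit *)

Section Structure.
Context (tc : R) (htc : in_oo a b tc) (hxc : xs tc = 0) (hyc : ys tc = 0).

Let r (t : R) : R := sqrt (sqdist (xs t) (ys t)).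

Lemma limit_direction_const (l l' : R) : l <= l' ->
  (forall t, l <= t <= l' -> in_oo a b t /\ 0 < sqdist (xs t) (ys t)) ->
  xs l / r l = xs l' / r l' /\ ys l / r l = ys l' / r l'.
Proof.
intros hl hD.
apply (motion_direction_const _ _ _ _ _ _ _ _ _ _
  limit_motion hl hD).
intros t ht; apply (limit_momentum_zero tc htc hxc hyc); now apply hD.
Qed.

(** The directions before and after the collision are the same at all small
    distances, so [turning_gap] applies to one fixed pair of directions with
    every [kappa > 0]: one of the two gaps has to vanish. *)
Lemma collision_rays (t0 : R) : in_oo a b t0 -> xs t0 = 0 -> ys t0 = 0 ->
  exists d th_in th_out, 0 < d /\
    (forall s, t0 - d <= s <= t0 + d -> (s - t0) ^ 2 <= sqdist (xs s) (ys s)) /\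
    (forall s m, t0 - d <= s <= t0 + d -> 0 <= m <= 1 ->
      sqdist (xs (t0 + m * (s - t0))) (ys (t0 + m * (s - t0))) <= m * sqdist (xs s) (ys s)) /\
    (forall s, t0 - d <= s <= t0 -> xs s = r s * cos th_in /\ ys s = r s * sin th_in) /\
    (forall s, t0 <= s <= t0 + d -> xs s = r s * cos th_out /\ ys s = r s * sin th_out) /\
    (th_out - th_in = PI / (1 - alpha / 2) \/ th_out - th_in = - (PI / (1 - alpha / 2))).
Proof.
intros ht0 hx0 hy0.
destruct (collision_convex t0 ht0 hx0 hy0)
  as [d [hd [hD [hgrow hchord]]]].
assert (hpos : forall s, t0 - d <= s <= t0 + d -> s <> t0 -> 0 < sqdist (xs s) (ys s)).
{ intros s hs hne; apply Rlt_le_trans with (2 := hgrow s hs).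
  destruct (Rtotal_order s t0) as [h | [h | h]]; [nra | contradiction | nra]. }
assert (dirp : forall s, t0 < s <= t0 + d ->
  xs s / r s = xs (t0 + d) / r (t0 + d) /\ ys s / r s = ys (t0 + d) / r (t0 + d)).
{ intros s hs; apply limit_direction_const; [lra|]; intros t ht.
  split; [apply hD | apply hpos]; lra. }
assert (dirm : forall s, t0 - d <= s < t0 ->
  xs s / r s = xs (t0 - d) / r (t0 - d) /\ ys s / r s = ys (t0 - d) / r (t0 - d)).
{ intros s hs; destruct (limit_direction_const (t0 - d) s) as [e1 e2]; [lra| |now split].
  intros t ht; split; [apply hD | apply hpos]; lra. }
set (eu := xs (t0 + d) / r (t0 + d)) in *; set (ev := ys (t0 + d) / r (t0 + d)) in *.
set (fu := xs (t0 - d) / r (t0 - d)) in *; set (fv := ys (t0 - d) / r (t0 - d)) in *.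
set (c := 1 - alpha / 2); assert (hc : 0 < c) by (unfold c; lra).
set (gap := fun s => rot_gap (s * (PI / 2 / c)) eu ev fu fv).
assert (hgap : forall kappa, 0 < kappa ->
  gap 1 <= 3 * (kappa * PI) ^ 2 \/ gap (-1) <= 3 * (kappa * PI) ^ 2).
{ intros kappa hk.
  destruct (near_collision t0 ht0 hx0 hy0
    (Rmax 1 (alpha * Rabs E / ((1 - alpha / 2) * kappa)))) as [d1 [hd1 [_ hJ]]].
  assert (m1 := Rmin_l d d1); assert (m2 := Rmin_r d d1).
  assert (m3 : 0 < Rmin d d1) by (apply Rmin_pos; lra); set (d2 := Rmin d d1) in *.
  assert (h := turning_gap t0 ht0 hx0 hy0 d2 kappa m3 hk).
  destruct (dirp (t0 + d2) ltac:(lra)) as [e1 e2].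
  destruct (dirm (t0 - d2) ltac:(lra)) as [e3 e4].
  unfold r in e1, e2, e3, e4.
  cbv zeta in h; rewrite e1, e2, e3, e4 in h; apply h.
  - intros s hs; apply hD; lra.
  - intros s hs; apply hgrow; lra.
  - generalize hJ; apply filter_imp; intros n hn s hs; apply hn; lra. }
assert (hzero : gap 1 = 0 \/ gap (-1) = 0).
{ assert (n1 : 0 <= gap 1) by apply sqdist_nonneg.
  assert (n2 : 0 <= gap (-1)) by apply sqdist_nonneg.
  destruct n1 as [n1 | n1]; [|now left]; destruct n2 as [n2 | n2]; [|now right].
  exfalso; assert (hpi := PI_RGT_0).
  (* [kappa <= 1] and [kappa <= m / (4 PI^2)] give [3 (kappa PI)^2 < m] *)
  set (m := Rmin (gap 1) (gap (-1))); assert (hm : 0 < m) by (now apply Rmin_pos).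
  assert (hm1 : m <= gap 1) by apply Rmin_l; assert (hm2 : m <= gap (-1)) by apply Rmin_r.
  assert (hq : 0 < m / (4 * PI ^ 2)) by (apply Rdiv_lt_0_compat; nra).
  set (kappa := Rmin 1 (m / (4 * PI ^ 2))).
  assert (hk : 0 < kappa) by (apply Rmin_pos; lra).
  assert (k1 : kappa <= 1) by apply Rmin_l.
  assert (k2 : kappa <= m / (4 * PI ^ 2)) by apply Rmin_r.
  assert (k3 : kappa * (4 * PI ^ 2) <= m) by (apply Rle_div_r in k2; [exact k2 | nra]).
  assert (k4 : 3 * (kappa * PI) ^ 2 < m).
  { assert (hp2 : 0 < PI ^ 2) by nra.
    replace (3 * (kappa * PI) ^ 2) with (3 * kappa * (kappa * PI ^ 2)) by ring.
    assert (0 < kappa * PI ^ 2) by nra; nra. }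
  destruct (hgap kappa hk); lra. }
destruct (polar_angle fu fv) as [th [ef1 ef2]].
{ apply sqdist_direction, hpos; lra. }
assert (hs : exists s, (s = 1 \/ s = -1) /\ gap s = 0).
{ destruct hzero as [h | h]; [exists 1 | exists (-1)]; auto. }
destruct hs as [s [hs1 hs2]]; unfold gap in hs2; rewrite ef1, ef2 in hs2.
apply rot_gap_polar in hs2; destruct hs2 as [ee1 ee2].
replace (th + 2 * (s * (PI / 2 / c))) with (th + s * (PI / c)) in ee1, ee2 by (field; lra).
assert (r0 : r t0 = 0).
{ unfold r; rewrite hx0, hy0; unfold sqdist; replace (0 ^ 2 + 0 ^ 2) with 0 by ring; apply sqrt_0. }
assert (back : forall z z', t0 - d <= z <= t0 + d -> z <> t0 -> xs z / r z = z' -> xs z = r z * z').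
{ intros z z' hz hne <-; assert (0 < r z) by (apply sqrt_lt_R0; now apply hpos). field; lra. }
assert (back' : forall z z', t0 - d <= z <= t0 + d -> z <> t0 -> ys z / r z = z' -> ys z = r z * z').
{ intros z z' hz hne <-; assert (0 < r z) by (apply sqrt_lt_R0; now apply hpos). field; lra. }
exists d, th, (th + s * (PI / c)).
split; [exact hd | split; [exact hgrow | split; [exact hchord | split; [|split]]]].
- intros z hz; destruct (Req_dec z t0) as [-> | hne]; [rewrite r0, hx0, hy0; lra|].
  destruct (dirm z ltac:(lra)) as [e1 e2]; rewrite ef1 in e1; rewrite ef2 in e2.
  split; [apply back | apply back']; auto; lra.
- intros z hz; destruct (Req_dec z t0) as [-> | hne]; [rewrite r0, hx0, hy0; lra|].
  destruct (dirp z ltac:(lra)) as [e1 e2]; rewrite ee1 in e1; rewrite ee2 in e2.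
  split; [apply back | apply back']; auto; lra.
- destruct hs1 as [-> | ->]; [left | right]; ring.
Qed.

(** Away from the origin the limit moves on a ray with a strictly concave
    distance: [rd] is its radial speed, and the whole speed. *)
Lemma limit_on_ray (t : R) : in_oo a b t -> 0 < sqdist (xs t) (ys t) ->
  exists d u v, 0 < d /\ sqdist u v = 1 /\
    let rd := fun s => Derive xs s * u + Derive ys s * v in
    (forall s, t - d <= s <= t + d -> xs s = r s * u /\ ys s = r s * v) /\
    (forall s, t - d <= s <= t + d -> is_derive r s (rd s)) /\
    (forall s s', t - d <= s -> s < s' -> s' <= t + d -> rd s' < rd s) /\
    continuous rd t /\ sqdist (Derive xs t) (Derive ys t) = rd t ^ 2.
Proof.
intros ht hN.
assert (hm := limit_motion).
assert (hr : 0 < r t) by (now apply sqrt_lt_R0).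
destruct (limit_near t (r t / 4) ht) as [d [hd [hD hnear]]]; [lra|].
assert (hpos : forall s, t - d <= s <= t + d -> 0 < sqdist (xs s) (ys s)).
{ intros s hs; destruct (hnear s hs) as [h1 h2].
  assert (h3 := radius_lipschitz (xs s) (ys s) (xs t) (ys t)); fold (r s) (r t) in h3.
  apply Rabs_le_between in h3; apply sqrt_lt_0_alt; rewrite sqrt_0; fold (r s); lra. }
set (u := xs t / r t); set (v := ys t / r t).
assert (hdir : forall s, t - d <= s <= t + d -> xs s = r s * u /\ ys s = r s * v).
{ intros s hs; assert (hrs : 0 < r s) by (apply sqrt_lt_R0; now apply hpos).
  assert (e : xs s / r s = u /\ ys s / r s = v).
  { destruct (Rle_dec s t).
    - apply limit_direction_const; [lra|]; intros z hz; split; [apply hD | apply hpos]; lra.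
    - destruct (limit_direction_const t s) as [e1 e2]; [lra | | now split].
      intros z hz; split; [apply hD | apply hpos]; lra. }
  destruct e as [<- <-]; split; field; lra. }
assert (huv : sqdist u v = 1) by (apply sqdist_direction, hN).
assert (hm' : forall s, t - d <= s <= t + d -> is_derive r s (Derive xs s * u + Derive ys s * v)).
{ intros s hs; assert (hrs : 0 < r s) by (apply sqrt_lt_R0; now apply hpos).
  assert (dN := motion_sqdist_derive _ _ _ _ _ _ _ _ hm s (conj (hD s hs) (hpos s hs))).
  assert (dr := is_derive_sqrt _ _ _ dN (hpos s hs)).
  replace (Derive xs s * u + Derive ys s * v) with
    (2 * virial (xs s) (ys s) (Derive xs s) (Derive ys s) / (2 * sqrt (sqdist (xs s) (ys s)))); [exact dr|].
  fold (r s); destruct (hdir s hs) as [e1 e2]; unfold virial; rewrite e1, e2; field; lra. }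
assert (hacc : forall s, t - d <= s <= t + d ->
  is_derive (fun s => Derive xs s * u + Derive ys s * v) s (- (mu * alpha) / Rpower (r s) (alpha + 2) * r s)).
{ intros s hs; destruct (hm s (conj (hD s hs) (hpos s hs))) as [_ [_ [_ [dp [dw _]]]]].
  fold (r s) in dp, dw; destruct (hdir s hs) as [e1 e2].
  assert (eF : - (mu * alpha) / Rpower (r s) (alpha + 2) * r s =
    - (mu * alpha) / Rpower (r s) (alpha + 2) * xs s * u +
    - (mu * alpha) / Rpower (r s) (alpha + 2) * ys s * v).
  { rewrite e1, e2; transitivity (- (mu * alpha) / Rpower (r s) (alpha + 2) * r s * sqdist u v);
      [rewrite huv; ring | unfold sqdist; ring]. }
  rewrite eF; auto_derive.
  - repeat split; eexists; eassumption.
  - rewrite (is_derive_unique (fun s : R => Derive xs s) _ _ dp),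
      (is_derive_unique (fun s : R => Derive ys s) _ _ dw); ring. }
exists d, u, v; split; [exact hd | split; [exact huv|]]; intros rd.
split; [exact hdir | split; [exact hm' | split; [|split]]].
- intros s s' h1 h2 h3.
  destruct (mean_value rd (fun s => - (mu * alpha) / Rpower (r s) (alpha + 2) * r s) s s' h2)
    as [z [hz ez]].
  { intros z hz; apply hacc; lra. }
  assert (hrz : 0 < r z) by (apply sqrt_lt_R0, hpos; lra).
  assert (hF : 0 < mu * alpha / Rpower (r z) (alpha + 2) * r z * (s' - s)).
  { repeat apply Rmult_lt_0_compat; try lra; apply Rinv_0_lt_compat, Rpower_gt_0. }
  unfold Rdiv in *; lra.
- apply (ex_derive_continuous (V := R_NormedModule)); eexists; apply hacc; lra.
- assert (hL := limit_momentum_zero tc htc hxc hyc t ht hN); unfold momentum in hL.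
  destruct (hdir t ltac:(lra)) as [e1 e2]; rewrite e1, e2 in hL.
  assert (hL' : u * Derive ys t - v * Derive xs t = 0) by nra.
  unfold rd; transitivity (sqdist (Derive xs t) (Derive ys t) * sqdist u v - (u * Derive ys t - v * Derive xs t) ^ 2).
  + rewrite huv, hL'; ring.
  + unfold sqdist; ring.
Qed.

Let q (t : R) : plane := (xs t, ys t).

Lemma ray_straight (l l' u v : R) (rd : R -> R) : sqdist u v = 1 ->
  (forall s, l <= s <= l' -> xs s = r s * u /\ ys s = r s * v) ->
  (forall s, l <= s <= l' -> is_derive r s (rd s)) ->
  (forall s, l < s < l' -> 0 < rd s) \/ (forall s, l < s < l' -> rd s < 0) ->
  travels_straight q l l'.
Proof.
intros huv hdir hder [hpos | hneg].
- apply (travels_along_axis q l l' u v r huv).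
  + intros t ht; unfold q; destruct (hdir t ht) as [<- <-]; reflexivity.
  + intros s s' h1 h2 h3; destruct (mean_value r rd s s' h2) as [z [hz ez]].
    { intros z hz; apply hder; lra. }
    specialize (hpos z ltac:(lra)); nra.
- apply (travels_along_axis_back q l l' u v r huv).
  + intros t ht; unfold q; destruct (hdir t ht) as [<- <-]; reflexivity.
  + intros s s' h1 h2 h3; destruct (mean_value r rd s s' h2) as [z [hz ez]].
    { intros z hz; apply hder; lra. }
    specialize (hneg z ltac:(lra)); nra.
Qed.

(** The radial speed decreases strictly.  If it is not 0 the limit keeps its
    direction near [t]; if it is 0 then so is the velocity, and conservation of
    energy puts the position on the Hill boundary, where the limit turns back. *)
Lemma straight_or_hill (t : R) : in_oo a b t -> 0 < sqdist (xs t) (ys t) ->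
  (exists d, 0 < d /\ travels_straight q (t - d) (t + d)) \/
  (- mu / Rpower (r t) alpha = E /\
   exists d, 0 < d /\ travels_straight q (t - d) t /\ travels_straight q t (t + d)).
Proof.
intros ht hN.
destruct (limit_on_ray t ht hN) as [d [u [v [hd [huv hray]]]]]; cbv zeta in hray.
set (rd := fun s => Derive xs s * u + Derive ys s * v).
destruct hray as [hdir [hder [hdec [hcont hspeed]]]].
change (forall s, t - d <= s <= t + d -> is_derive r s (rd s)) in hder.
change (forall s s', t - d <= s -> s < s' -> s' <= t + d -> rd s' < rd s) in hdec.
change (continuous rd t) in hcont; change (sqdist (Derive xs t) (Derive ys t) = rd t ^ 2) in hspeed.
destruct (Req_dec (rd t) 0) as [h0 | h0].
- right; split.
  + destruct (limit_motion t (conj ht hN))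
      as [_ [_ [_ [_ [_ he]]]]].
    rewrite hspeed, h0 in he; fold (r t) in he; unfold Rdiv in *; lra.
  + exists d; split; [exact hd | split].
    * apply (ray_straight _ _ u v rd huv); [intros s hs; apply hdir; lra
        | intros s hs; apply hder; lra | left; intros s hs].
      rewrite <- h0; apply hdec; lra.
    * apply (ray_straight _ _ u v rd huv); [intros s hs; apply hdir; lra
        | intros s hs; apply hder; lra | right; intros s hs].
      rewrite <- h0; apply hdec; lra.
- left.
  assert (hloc : locally t (fun s => Rabs (rd s - rd t) < Rabs (rd t))).
  { exact (proj1 (filterlim_locally rd (rd t)) hcont (mkposreal _ (Rabs_pos_lt _ h0))). }
  destruct hloc as [[e he] h].
  assert (m1 := Rmin_l d (e / 2)); assert (m2 := Rmin_r d (e / 2)).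
  assert (m3 : 0 < Rmin d (e / 2)) by (apply Rmin_pos; lra); set (d' := Rmin d (e / 2)) in *.
  assert (hs' : forall s, t - d' < s < t + d' -> Rabs (rd s - rd t) < Rabs (rd t)).
  { intros s hs; apply h; change (Rabs (s - t) < e); apply Rabs_def1; lra. }
  exists d'; split; [exact m3|].
  apply (ray_straight _ _ u v rd huv); [intros s hs; apply hdir; lra
    | intros s hs; apply hder; lra |].
  destruct (Rtotal_order (rd t) 0) as [hlt | [heq | hgt]]; [right | contradiction | left];
    intros s hs; specialize (hs' s hs); apply Rabs_def2 in hs'.
  + rewrite Rabs_left in hs' by lra; lra.
  + rewrite Rabs_pos_eq in hs' by lra; lra.
Qed.

Lemma collision_straight (t0 : R) : in_oo a b t0 -> xs t0 = 0 -> ys t0 = 0 ->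
  exists d, 0 < d /\ travels_straight q (t0 - d) t0 /\ travels_straight q t0 (t0 + d).
Proof.
intros ht0 hx0 hy0.
destruct (collision_rays t0 ht0 hx0 hy0) as [d [th_in [th_out [hd [hgrow [hchord [hin [hout _]]]]]]]].
assert (unit : forall th, sqdist (cos th) (sin th) = 1).
{ intros th; generalize (sin2_cos2 th); unfold sqdist, Rsqr; lra. }
(* the barycentric coordinate treats both sides of the collision at once *)
assert (mono : forall s m, t0 - d <= s <= t0 + d -> s <> t0 -> 0 <= m < 1 ->
  r (t0 + m * (s - t0)) < r s).
{ intros s m hs hne hm; apply sqrt_lt_1_alt; split; [apply sqdist_nonneg|].
  assert (h1 := hchord s m hs ltac:(lra)); assert (h2 := hgrow s hs).
  assert (h3 : 0 < (s - t0) ^ 2) by (apply pow2_gt_0; lra).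
  nra. }
exists d; split; [exact hd | split].
- apply (travels_along_axis_back q _ _ _ _ r (unit th_in)).
  + intros t ht; unfold q; destruct (hin t ht) as [<- <-]; reflexivity.
  + intros s s' h1 h2 h3; set (m := (t0 - s') / (t0 - s)).
    assert (hm : 0 <= m < 1).
    { unfold m; split; [apply Rle_div_r | apply Rlt_div_l]; lra. }
    replace s' with (t0 + m * (s - t0)) by (unfold m; field; lra).
    apply mono; lra.
- apply (travels_along_axis q _ _ _ _ r (unit th_out)).
  + intros t ht; unfold q; destruct (hout t ht) as [<- <-]; reflexivity.
  + intros s s' h1 h2 h3; set (m := (s - t0) / (s' - t0)).
    assert (hm : 0 <= m < 1).
    { unfold m; split; [apply Rle_div_r | apply Rlt_div_l]; lra. }
    replace s with (t0 + m * (s' - t0)) by (unfold m; field; lra).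
    apply mono; lra.
Qed.

Lemma straight_sides (t : R) : in_oo a b t ->
  exists d, 0 < d /\ travels_straight q (t - d) t /\ travels_straight q t (t + d).
Proof.
intros ht; destruct (Rle_lt_or_eq_dec _ _ (sqdist_nonneg (xs t) (ys t))) as [hN | hN].
- destruct (straight_or_hill t ht hN) as [[d [hd hst]] | [_ h]]; [|exact h].
  exists d; split; [exact hd | split]; apply (travels_straight_sub _ _ _ _ _ hst); lra.
- destruct (sqdist_eq_0 _ _ (eq_sym hN)); now apply collision_straight.
Qed.

End Structure.

End Limit.

(** * From coordinates to the plane *)

Lemma plane_derive_coords (q : R -> plane) (t : R) (v : plane) :
  is_derive q t v ->
  is_derive (fun s => fst (q s)) t (fst v) /\ is_derive (fun s => snd (q s)) t (snd v).
Proof.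
intros hq; split.
- apply (filterdiff_ext_lin _ (fun s : R => fst (scal s v : plane))); [|reflexivity].
  apply (filterdiff_comp' q (fun z : plane => fst z) t _ (fun z : plane => fst z) hq).
  apply filterdiff_linear, is_linear_fst.
- apply (filterdiff_ext_lin _ (fun s : R => snd (scal s v : plane))); [|reflexivity].
  apply (filterdiff_comp' q (fun z : plane => snd z) t _ (fun z : plane => snd z) hq).
  apply filterdiff_linear, is_linear_snd.
Qed.

Lemma is_linear_pair_l : is_linear (fun s : R_NormedModule => ((s, 0) : plane)).
Proof.
split.
- intros s s'; apply injective_projections; simpl; [reflexivity|].
  unfold plus; simpl; ring.
- intros k s; apply injective_projections; simpl; [reflexivity|].
  unfold scal; simpl; unfold mult; simpl; ring.
- exists 1; split; [lra|]; intros s; rewrite norm_planeE; simpl.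
  replace (s * (s * 1) + 0 * (0 * 1)) with (Rsqr s) by (unfold Rsqr; ring).
  rewrite sqrt_Rsqr_abs, Rmult_1_l; apply Rle_refl.
Qed.

Lemma is_linear_pair_r : is_linear (fun s : R_NormedModule => ((0, s) : plane)).
Proof.
split.
- intros s s'; apply injective_projections; simpl; [|reflexivity].
  unfold plus; simpl; ring.
- intros k s; apply injective_projections; simpl; [|reflexivity].
  unfold scal; simpl; unfold mult; simpl; ring.
- exists 1; split; [lra|]; intros s; rewrite norm_planeE; simpl.
  replace (0 * (0 * 1) + s * (s * 1)) with (Rsqr s) by (unfold Rsqr; ring).
  rewrite sqrt_Rsqr_abs, Rmult_1_l; apply Rle_refl.
Qed.

Lemma plane_derive_pair (q : R -> plane) (t : R) (v : plane) :
  is_derive (fun s => fst (q s)) t (fst v) -> is_derive (fun s => snd (q s)) t (snd v) ->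
  is_derive q t v.
Proof.
intros h1 h2.
apply (is_derive_ext (fun s => plus ((fst (q s), 0) : plane) ((0, snd (q s)) : plane))).
{ intros s; apply injective_projections; simpl; unfold plus; simpl; ring. }
replace v with (plus ((fst v, 0) : plane) ((0, snd v) : plane)).
2:{ apply injective_projections; simpl; unfold plus; simpl; ring. }
apply (is_derive_plus (V := plane)).
- apply (filterdiff_ext_lin _ (fun s : R => ((scal s (fst v), 0) : plane))).
  + apply (filterdiff_comp' (fun s => fst (q s)) (fun z : R => (z, 0) : plane) t _
      (fun z : R => (z, 0) : plane) h1).
    apply filterdiff_linear, is_linear_pair_l.
  + intros s; apply injective_projections; simpl; [reflexivity|].
    unfold scal; simpl; unfold mult; simpl; ring.
- apply (filterdiff_ext_lin _ (fun s : R => ((0, scal s (snd v)) : plane))).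
  + apply (filterdiff_comp' (fun s => snd (q s)) (fun z : R => (0, z) : plane) t _
      (fun z : R => (0, z) : plane) h2).
    apply filterdiff_linear, is_linear_pair_r.
  + intros s; apply injective_projections; simpl; [|reflexivity].
    unfold scal; simpl; unfold mult; simpl; ring.
Qed.

Lemma norm_radius (z : plane) : norm z = sqrt (sqdist (fst z) (snd z)).
Proof. apply norm_planeE. Qed.

Lemma norm_coords (z : plane) : Rabs (fst z) <= norm z /\ Rabs (snd z) <= norm z.
Proof.
rewrite norm_radius, <- !sqrt_Rsqr_abs; unfold sqdist.
split; apply sqrt_le_1_alt; unfold Rsqr; nra.
Qed.

Lemma plane_eq_zero (z : plane) : z = zero <-> sqdist (fst z) (snd z) = 0.
Proof.
split.
- intros ->; unfold sqdist, zero; simpl; unfold zero; simpl; ring.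
- intros h; apply sqdist_eq_0 in h; now apply injective_projections.
Qed.

Lemma noncollision_motion (mu alpha E : R) (a b : Rbar) (q : R -> plane) :
  noncollision_solution mu alpha E a b q ->
  let x := fun t => fst (q t) in let y := fun t => snd (q t) in
  motion mu alpha E (in_oo a b) x y (Derive x) (Derive y).
Proof.
intros [hne [v [hv hE]]] x y t ht.
assert (hxy : forall s, in_oo a b s -> Derive x s = fst (v s) /\ Derive y s = snd (v s)).
{ intros s hs; destruct (plane_derive_coords _ _ _ (proj1 (hv s hs))) as [h1 h2].
  split; now apply is_derive_unique. }
destruct (in_oo_neighbourhood a b t ht) as [d [hd hD]].
assert (hloc : locally t (fun s => fst (v s) = Derive x s /\ snd (v s) = Derive y s)).
{ exists (mkposreal d hd); intros s hs; change (Rabs (s - t) < d) in hs.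
  apply Rabs_def2 in hs; destruct (hxy s (hD s ltac:(lra))); now split. }
destruct (hv t ht) as [h1 h2]; apply plane_derive_coords in h1, h2.
destruct h1 as [h1 h1']; destruct h2 as [h2 h2'].
destruct (hxy t ht) as [e1 e2]; rewrite e1, e2.
assert (er : norm (q t) = sqrt (sqdist (x t) (y t))) by apply norm_radius.
split; [|split; [exact h1 | split; [exact h1' | split; [|split]]]].
- destruct (sqdist_nonneg (x t) (y t)) as [h | h]; [exact h|].
  exfalso; apply (hne t ht), plane_eq_zero; now symmetry.
- apply (is_derive_ext_loc (fun s => fst (v s))).
  + generalize hloc; apply filter_imp; intros s hs; apply hs.
  + rewrite <- er; exact h2.
- apply (is_derive_ext_loc (fun s => snd (v s))).
  + generalize hloc; apply filter_imp; intros s hs; apply hs.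
  + rewrite <- er; exact h2'.
- assert (h := hE t ht); unfold potential in h; rewrite er, norm_radius, pow2_sqrt in h
    by apply sqdist_nonneg.
  unfold Rdiv in *; lra.
Qed.

Lemma motion_newton (mu alpha E : R) (D : R -> Prop) (q v : R -> plane) :
  motion mu alpha E D (fun t => fst (q t)) (fun t => snd (q t))
    (fun t => fst (v t)) (fun t => snd (v t)) ->
  newton mu alpha D q v.
Proof.
intros hm t ht; destruct (hm t ht) as [_ [h1 [h2 [h3 [h4 _]]]]].
cbv beta in h3, h4; rewrite <- norm_radius in h3, h4; split; now apply plane_derive_pair.
Qed.

Lemma travels_straight_ext (q q' : R -> plane) (s s' : R) :
  (forall t, q t = q' t) -> travels_straight q s s' -> travels_straight q' s s'.
Proof.
intros e [u [hu h]]; exists u; split; [exact hu|]; intros x y h1 h2 h3.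
rewrite <- !e; now apply h.
Qed.

(** All the arguments about the limit use the family along a single sequence of
    parameters tending to 0. *)
Lemma at_right_0_seq (P : R -> Prop) (e : R) : 0 < e -> at_right 0 P ->
  eventually (fun n => P (e / (INR n + 2))).
Proof.
intros he [[d hd] h].
destruct (INR_unbounded (e / d)) as [N hN]; exists N; intros n hn.
assert (hn' := le_INR _ _ hn); assert (hn0 := pos_INR n).
assert (hp : 0 < e / (INR n + 2)) by (apply Rdiv_lt_0_compat; lra).
apply h; [|exact hp].
change (Rabs (e / (INR n + 2) - 0) < d); rewrite Rminus_0_r, Rabs_pos_eq by lra.
apply Rlt_div_l; [lra|]; apply Rlt_div_l in hN; [|exact hd]; nra.
Qed.

Theorem theorem4 (alpha mu c E : R)
  (halpha : 0 < alpha < 2) (hmu : 0 < mu) (hc : c = 1 - alpha / 2)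
  (a b : Rbar) (eps0 : R) (heps0 : 0 < eps0)
  (gamma : R -> R -> plane) (gamma_star : R -> plane)
  (hsol : forall eps : R, 0 < eps < eps0 ->
     noncollision_solution mu alpha E a b (gamma eps))
  (hlim : converges_to a b gamma gamma_star)
  (hcoll : exists t0 : R, in_oo a b t0 /\ gamma_star t0 = zero) :
  piecewise_linear a b gamma_star /\
  (forall t : R, in_oo a b t -> vertex gamma_star t ->
     gamma_star t = zero \/ hill_boundary mu alpha E (gamma_star t)) /\
  (exists v : R -> plane,
     newton mu alpha (fun t => in_oo a b t /\ gamma_star t <> zero)
       gamma_star v) /\
  (forall t : R, in_oo a b t -> gamma_star t = zero ->
     turns_by gamma_star t (PI / c)).
Proof.
set (eps := fun n => eps0 / (INR n + 2)).
set (x := fun n t => fst (gamma (eps n) t)); set (y := fun n t => snd (gamma (eps n) t)).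
set (xs := fun t => fst (gamma_star t)); set (ys := fun t => snd (gamma_star t)).
assert (hm : forall n, motion mu alpha E (in_oo a b) (x n) (y n) (Derive (x n)) (Derive (y n))).
{ intros n; apply (noncollision_motion mu alpha E a b (gamma (eps n))), hsol.
  assert (hn := pos_INR n); unfold eps; split; [apply Rdiv_lt_0_compat; lra|].
  apply Rlt_div_l; nra. }
assert (hcv : forall l l', in_oo a b l -> in_oo a b l' -> forall eta, 0 < eta ->
  eventually (fun n => forall t, l <= t <= l' ->
    Rabs (x n t - xs t) < eta /\ Rabs (y n t - ys t) < eta)).
{ intros l l' hl hl' eta heta.
  generalize (at_right_0_seq _ eps0 heps0 (hlim l l' hl hl' eta heta)).
  apply filter_imp; intros n hn t ht; specialize (hn t ht).
  destruct (norm_coords (minus (gamma (eps n) t) (gamma_star t))) as [h1 h2].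
  split; [apply Rle_lt_trans with (1 := h1) | apply Rle_lt_trans with (1 := h2)]; exact hn. }
assert (hq : forall t, (xs t, ys t) = gamma_star t).
{ intros t; symmetry; apply surjective_pairing. }
assert (hzero : forall t, gamma_star t = zero -> xs t = 0 /\ ys t = 0).
{ intros t h; unfold xs, ys; rewrite h; now split. }
assert (hpos : forall t, gamma_star t <> zero -> 0 < sqdist (xs t) (ys t)).
{ intros t h; destruct (sqdist_nonneg (xs t) (ys t)) as [h' | h']; [exact h'|].
  exfalso; apply h, plane_eq_zero; now symmetry. }
destruct hcoll as [tc [htc hc0]]; destruct (hzero tc hc0) as [hxc hyc].
split; [|split; [|split]].
- intros s s' hs hs' hlt; apply subdivide; [lra | |].
  + intros l l' r r' h h1 _ h2; exact (travels_straight_sub _ _ _ _ _ h h1 h2).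
  + intros t ht.
    destruct (straight_sides mu alpha E halpha hmu a b x y _ _ xs ys hm hcv tc htc hxc hyc t)
      as [d [hd [h1 h2]]].
    { now apply (in_oo_segment a b s s'). }
    exists d; split; [exact hd|].
    split; now apply (travels_straight_ext (fun t => (xs t, ys t))).
- intros t ht hvert; destruct (Classical_Prop.classic (gamma_star t = zero)) as [h0 | h0];
    [now left | right; split; [exact h0|]].
  destruct (straight_or_hill mu alpha E halpha hmu a b x y _ _ xs ys hm hcv tc htc hxc hyc
    t ht (hpos t h0)) as [[d [hd hst]] | [hE _]].
  + exfalso; apply hvert; exists d; split; [exact hd|].
    now apply (travels_straight_ext (fun t => (xs t, ys t))).
  + unfold potential; rewrite norm_radius; exact hE.
- exists (fun t => (Derive xs t, Derive ys t)).
  apply (motion_newton mu alpha E); intros t [ht h0].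
  apply (limit_motion mu alpha E halpha a b x y _ _ xs ys hm hcv t); split; auto.
- intros t ht h0; destruct (hzero t h0) as [hx0 hy0].
  destruct (collision_rays mu alpha E halpha hmu a b x y _ _ xs ys hm hcv tc htc hxc hyc
    t ht hx0 hy0) as [d [th_in [th_out [hd [hgrow [_ [hin [hout hturn]]]]]]]].
  rewrite <- hc in hturn.
  assert (hr : forall s, t - d <= s <= t + d -> s <> t -> 0 < sqrt (sqdist (xs s) (ys s))).
  { intros s hs hne; apply sqrt_lt_R0, Rlt_le_trans with (2 := hgrow s hs), pow2_gt_0; lra. }
  exists th_in, th_out; split; [|split].
  + exists (mkposreal d hd); intros s hs hlt; change (Rabs (s - t) < d) in hs.
    apply Rabs_def2 in hs; exists (sqrt (sqdist (xs s) (ys s))); split; [apply hr; lra|].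
    destruct (hin s ltac:(lra)) as [<- <-]; symmetry; apply hq.
  + exists (mkposreal d hd); intros s hs hlt; change (Rabs (s - t) < d) in hs.
    apply Rabs_def2 in hs; exists (sqrt (sqdist (xs s) (ys s))); split; [apply hr; lra|].
    destruct (hout s ltac:(lra)) as [<- <-]; symmetry; apply hq.
  + destruct hturn as [h | h]; [left | right]; exists 0%Z; rewrite h; ring.
Qed.
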